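(* Let $\mathcal G$ and $\mathcal H$ be Lie groupoids and let $X$ be a biprincipal diffeological $(\mathcal G,\mathcal H)$-bibundle. Then $X$ is a biprincipal bibundle in the Lie sense. That is, a diffeological Morita equivalence between two Lie groupoids via diffeological bibundles is a Lie Morita equivalence via a bibundle in the Lie groupoid sense.
   Context: Diffeology. A parametrisation of a set $X$ is a map $p\colon U_p\to X$ from an open subset $U_p$ of some $\mathbb{R}^n$, $n\ge 0$. A diffeology on $X$ is a set of parametrisations, called plots, containing all constant parametrisations, such that a parametrisation that restricts to a plot on each member of an open cover of its domain is a plot, and such that $p\circ f$ is a plot for every plot $p$ and every smooth map $f\colon V\to U_p$ from an open subset $V$ of some $\mathbb{R}^m$. A map $F\colon X\to Y$ of diffeological spaces is smooth if $F\circ p$ is a plot of $Y$ for every plot $p$ of $X$; a diffeomorphism is a smooth bijection with smooth inverse. A subset of $X$ carries the plots of $X$ with image in it; products carry the parametrisations whose components are plots; fibre products $X\times_{f,g}Y=\{(x,y):f(x)=g(y)\}$ carry the subset diffeology of the product. A smooth surjection $F\colon X\to Y$ is a subduction if for every plot $p$ of $Y$ there are an open cover $\{U_\alpha\}$ of $U_p$ and plots $q_\alpha\colon U_\alpha\to X$ with $p|_{U_\alpha}=F\circ q_\alpha$. Smooth manifolds are regarded as diffeological spaces whose plots are the smooth parametrisations; a diffeological space ''is a manifold'' if its diffeology arises in this way from a (necessarily unique) smooth manifold structure. Groupoids. A diffeological groupoid $\mathcal G=(\mathcal G_1\rightrightarrows\mathcal G_0)$ is a small groupoid whose sets of objects $\mathcal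 G_0$ and arrows $\mathcal G_1$ are diffeological spaces such that the source $s$, target $t$, unit $x\mapsto u_x$, multiplication ($gh$ defined when $s(g)=t(h)$) and inversion are smooth. A Lie groupoid is a diffeological groupoid with $\mathcal G_0$ a (Hausdorff, second-countable) smooth manifold, $\mathcal G_1$ a smooth manifold not required to be Hausdorff or second-countable, and $s,t$ submersions. Bibundles. A left action of $\mathcal G$ on a diffeological space $X$ with smooth anchor $l\colon X\to\mathcal G_0$ is a smooth map $\mathcal G_1\times_{s,l}X\to X$, $(g,x)\mapsto gx$, with $l(gx)=t(g)$, $g'(gx)=(g'g)x$, $u_{l(x)}x=x$. A right action of $\mathcal H$ with smooth anchor $r\colon X\to\mathcal H_0$ is a smooth map $X\times_{r,t}\mathcal H_1\to X$ with $r(xh)=s(h)$, $(xh)h'=x(hh')$, $xu_{r(x)}=x$. A diffeological $(\mathcal G,\mathcal H)$-bibundle is a diffeological space $X$ with a left $\mathcal G$-action with anchor $l_X$ and a right $\mathcal H$-action with anchor $r_X$ such that $l_X$ is $\mathcal H$-invariant, $r_X$ is $\mathcal G$-invariant and the actions commute. It is right principal if $l_X\colon X\to\mathcal G_0$ is a subduction and $X\times_{r_X,t}\mathcal H_1\to X\times_{l_X,l_X}X$, $(x,h)\mapsto(x,xh)$, is a diffeomorphism; left principal if $r_X\colon X\to\mathcal H_0$ is a subduction and $\mathcal G_1\times_{s,l_X}X\to X\times_{r_X,r_X}X$, $(g,x)\mapsto(gx,x)$, is a diffeomorphism; biprincipal if both. A diffeological Morita equivalence via bibundles is a biprincipal diffeological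 bibundle. For Lie groupoids $\mathcal G,\mathcal H$, such a bibundle is biprincipal in the Lie sense if $X$ is a smooth manifold (as for arrow spaces of Lie groupoids, not required to be Hausdorff or second-countable), $l_X$ and $r_X$ are surjective submersions, the actions are smooth maps of manifolds, and the two maps $(x,h)\mapsto(x,xh)$ and $(g,x)\mapsto(gx,x)$ above are diffeomorphisms of manifolds. A Lie Morita equivalence via bibundles is such a bibundle. *)

(* Defs.v *)
From mathcomp Require Import all_boot all_order all_algebra.
From mathcomp Require Import all_classical all_reals all_analysis.
Import numFieldNormedType.Exports.

Set Implicit Arguments.
Unset Strict Implicit.
Unset Printing Implicit Defensive.

Local Open Scope classical_set_scope.
Local Open Scope ring_scope.

(* A map defined on an open set U of R^m is represented by a pair of U and a
   total function on 'rV[R]_m, whose values outside U are irrelevant. *)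

Section Smooth.
Variable R : realType.

(* f is of class C^(k+1) when it is differentiable with a C^k differential; in
   finite dimension the latter may be tested on each vector v. *)
Fixpoint Ck (k m n : nat) (U : set 'rV[R]_m) (f : 'rV[R]_m -> 'rV[R]_n) : Prop :=
  match k with
  | 0%N => forall x, U x -> {for x, continuous f}
  | k'.+1 => (forall x, U x -> differentiable f x) /\
             (forall v : 'rV[R]_m, Ck k' U (fun x => 'd f x v))
  end.

Definition smooth_on (m n : nat) (U : set 'rV[R]_m) (f : 'rV[R]_m -> 'rV[R]_n) :=
  forall k, Ck k U f.

End Smooth.

Section Diffeology.
Variable R : realType.

Record dspace := DSpace {
  carrier :> Type;
  plot : forall n : nat, set 'rV[R]_n -> ('rV[R]_n -> carrier) -> Prop;
  plot_open : forall n (U : set 'rV[R]_n) p, plot U p -> open U;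
  (* being a plot only depends on the values on the domain *)
  plot_ext : forall n (U : set 'rV[R]_n) p q,
    plot U p -> (forall x, U x -> p x = q x) -> plot U q;
  plot_cst : forall n (U : set 'rV[R]_n) (a : carrier),
    open U -> plot U (fun=> a);
  plot_local : forall n (U : set 'rV[R]_n) p (I : Type) (V : I -> set 'rV[R]_n),
    U = \bigcup_i V i -> (forall i, open (V i)) ->
    (forall i, plot (V i) p) -> plot U p;
  plot_comp : forall n m (U : set 'rV[R]_n) p (V : set 'rV[R]_m)
      (f : 'rV[R]_m -> 'rV[R]_n),
    plot U p -> open V -> smooth_on V f -> (forall x, V x -> U (f x)) ->
    plot V (p \o f)
}.

Definition dsmooth (X Y : dspace) (F : X -> Y) :=
  forall n (U : set 'rV[R]_n) p, plot U p -> plot U (F \o p).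

Definition diffeomorphism (X Y : dspace) (F : X -> Y) :=
  dsmooth F /\ exists F' : Y -> X, [/\ dsmooth F', cancel F F' & cancel F' F].

Definition subduction (X Y : dspace) (F : X -> Y) :=
  [/\ dsmooth F,
      forall y, exists x, F x = y &
      forall n (U : set 'rV[R]_n) p, plot U p ->
        exists (I : Type) (V : I -> set 'rV[R]_n) (q : I -> 'rV[R]_n -> X),
          U = \bigcup_i V i /\
          forall i, plot (V i) (q i) /\ forall x, V i x -> p x = F (q i x)].

Section Subset.
Variables (X : dspace) (A : X -> Prop).

Definition sub_plot n (U : set 'rV[R]_n) (p : 'rV[R]_n -> {x : X | A x}) :=
  plot U (fun z => sval (p z)).

Program Definition dsub : dspace := @DSpace {x : X | A x} sub_plot _ _ _ _ _.
Next Obligation. by move=> n U p /plot_open. Qed.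
Next Obligation.
by move=> n U p q pU pq; apply: plot_ext pU _ => x Ux; rewrite pq.
Qed.
Next Obligation. by move=> n U a oU; apply: plot_cst. Qed.
Next Obligation. by move=> n U p I V UV oV pV; apply: plot_local UV oV pV. Qed.
Next Obligation.
by move=> n m U p V f pU oV sf fVU; apply: (plot_comp pU oV sf fVU).
Qed.

End Subset.

Section Product.
Variables X Y : dspace.

Definition prod_plot n (U : set 'rV[R]_n) (p : 'rV[R]_n -> X * Y) :=
  plot U (fun z => (p z).1) /\ plot U (fun z => (p z).2).

Program Definition dprod : dspace := @DSpace (X * Y)%type prod_plot _ _ _ _ _.
Next Obligation. by move=> n U p [/plot_open]. Qed.
Next Obligation.
by move=> n U p q [p1 p2] pq; split; [apply: plot_ext p1 _|apply: plot_ext p2 _]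
  => x Ux; rewrite pq.
Qed.
Next Obligation. by move=> n U a oU; split; apply: plot_cst. Qed.
Next Obligation.
move=> n U p I V UV oV pV.
by split; apply: plot_local UV oV _ => i; have [] := pV i.
Qed.
Next Obligation.
move=> n m U p V f [p1 p2] oV sf fVU.
by split; [apply: (plot_comp p1 oV sf fVU)|apply: (plot_comp p2 oV sf fVU)].
Qed.

End Product.

Definition fibprod (X Y : dspace) (Z : Type) (f : X -> Z) (g : Y -> Z) : dspace :=
  @dsub (dprod X Y) (fun xy => f xy.1 = g xy.2).

Definition fpair (X Y : dspace) (Z : Type) (f : X -> Z) (g : Y -> Z)
    (x : X) (y : Y) (e : f x = g y) : fibprod f g :=
  exist (fun xy : X * Y => f xy.1 = g xy.2) (x, y) e.

End Diffeology.

Arguments dsmooth {R X Y}.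
Arguments diffeomorphism {R X Y}.
Arguments subduction {R X Y}.

Section Manifold.
Variable R : realType.

(* A bijection cmap from cdom onto an open set of R^n; the maps cmap and cinv
   are irrelevant outside cdom and its image. *)
Record chart (X : Type) (n : nat) := Chart {
  cdom : set X;
  cmap : X -> 'rV[R]_n;
  cinv : 'rV[R]_n -> X;
  cmap_open : open (cmap @` cdom);
  cmapK : forall x, cdom x -> cinv (cmap x) = x
}.

Record manifold (X : Type) := Manifold {
  mdim : nat;
  atlas : set (chart X mdim);
  atlas_cover : forall x, exists2 c, atlas c & cdom c x;
  atlas_compat : forall c c', atlas c -> atlas c' ->
    open (cmap c @` (cdom c `&` cdom c')) /\
    smooth_on (cmap c @` (cdom c `&` cdom c')) (cmap c' \o cinv c)
}.

Arguments atlas {X} m c.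

(* the topology of a manifold *)
Definition mopen (X : Type) (M : manifold X) (A : set X) :=
  forall c, atlas M c -> open (cmap c @` (cdom c `&` A)).

Definition mhausdorff (X : Type) (M : manifold X) :=
  forall x y : X, x <> y ->
    exists A B, [/\ mopen M A, mopen M B, A x, B y & A `&` B = set0].

Definition msecond_countable (X : Type) (M : manifold X) :=
  exists B : nat -> set X,
    (forall i, mopen M (B i)) /\
    forall A x, mopen M A -> A x -> exists2 i, B i x & B i `<=` A.

Definition msmooth (X Y : Type) (M : manifold X) (N : manifold Y) (f : X -> Y) :=
  forall c c', atlas M c -> atlas N c' ->
    open (cmap c @` (cdom c `&` f @^-1` cdom c')) /\
    smooth_on (cmap c @` (cdom c `&` f @^-1` cdom c')) (cmap c' \o f \o cinv c).

Definition mdiffeomorphism (X Y : Type) (M : manifold X) (N : manifold Y)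
    (f : X -> Y) :=
  msmooth M N f /\
  exists f' : Y -> X, [/\ msmooth N M f', cancel f f' & cancel f' f].

Definition submersion (X Y : Type) (M : manifold X) (N : manifold Y)
    (f : X -> Y) :=
  msmooth M N f /\
  forall c c' x, atlas M c -> atlas N c' -> cdom c x -> cdom c' (f x) ->
    forall w : 'rV[R]_(mdim N), exists v : 'rV[R]_(mdim M),
      'd (cmap c' \o f \o cinv c) (cmap c x) v = w.

(* the smooth parametrisations of a manifold *)
Definition mplot (X : Type) (M : manifold X) (n : nat) (U : set 'rV[R]_n)
    (p : 'rV[R]_n -> X) :=
  open U /\
  forall c, atlas M c ->
    open (U `&` p @^-1` cdom c) /\
    smooth_on (U `&` p @^-1` cdom c) (cmap c \o p).

(* The diffeology of X arises from the manifold structure M; up to equivalence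
   of atlases there is at most one such M. *)
Definition arises_from (X : dspace R) (M : manifold X) :=
  forall n (U : set 'rV[R]_n) p, plot U p <-> mplot M U p.

End Manifold.

Arguments arises_from {R}.

Section Groupoid.
Variable R : realType.

Record dgroupoid := DGroupoid {
  obj : dspace R;
  arr : dspace R;
  src : arr -> obj;
  tgt : arr -> obj;
  unt : obj -> arr;
  gmul : fibprod src tgt -> arr;
  ginv : arr -> arr;
  src_smooth : dsmooth src;
  tgt_smooth : dsmooth tgt;
  unt_smooth : dsmooth unt;
  gmul_smooth : dsmooth gmul;
  ginv_smooth : dsmooth ginv;
  src_unt : forall x, src (unt x) = x;
  tgt_unt : forall x, tgt (unt x) = x;
  src_mul : forall g h (e : src g = tgt h), src (gmul (fpair e)) = src h;
  tgt_mul : forall g h (e : src g = tgt h), tgt (gmul (fpair e)) = tgt g;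
  gmulA : forall g h k (e : src g = tgt h) (e' : src h = tgt k)
      (e1 : src (gmul (fpair e)) = tgt k) (e2 : src g = tgt (gmul (fpair e'))),
    gmul (fpair e1) = gmul (fpair e2);
  gmul1g : forall g (e : src (unt (tgt g)) = tgt g), gmul (fpair e) = g;
  gmulg1 : forall g (e : src g = tgt (unt (src g))), gmul (fpair e) = g;
  src_inv : forall g, src (ginv g) = tgt g;
  tgt_inv : forall g, tgt (ginv g) = src g;
  gmulVg : forall g (e : src (ginv g) = tgt g), gmul (fpair e) = unt (src g);
  gmulgV : forall g (e : src g = tgt (ginv g)), gmul (fpair e) = unt (tgt g)
}.

Record lie_groupoid := LieGroupoid {
  lie_dgroupoid :> dgroupoid;
  mobj : manifold R (obj lie_dgroupoid);
  marr : manifold R (arr lie_dgroupoid);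
  mobj_arises : arises_from (obj lie_dgroupoid) mobj;
  marr_arises : arises_from (arr lie_dgroupoid) marr;
  mobj_hausdorff : mhausdorff mobj;
  mobj_second_countable : msecond_countable mobj;
  src_submersion : submersion marr mobj (@src lie_dgroupoid);
  tgt_submersion : submersion marr mobj (@tgt lie_dgroupoid)
}.

End Groupoid.

Arguments src {R d}.
Arguments tgt {R d}.
Arguments unt {R d}.
Arguments gmul {R d}.

Section Bibundle.
Variable R : realType.

Record bibundle (G H : dgroupoid R) := Bibundle {
  bspace :> dspace R;
  lanch : bspace -> obj G;
  ranch : bspace -> obj H;
  lact : fibprod (@src R G) lanch -> bspace;
  ract : fibprod ranch (@tgt R H) -> bspace;
  lanch_smooth : dsmooth lanch;
  ranch_smooth : dsmooth ranch;
  lact_smooth : dsmooth lact;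
  ract_smooth : dsmooth ract;
  lanch_lact : forall g x (e : src g = lanch x), lanch (lact (fpair e)) = tgt g;
  lactA : forall g' g x (e : src g' = tgt g) (e' : src g = lanch x)
      (e1 : src g' = lanch (lact (fpair e')))
      (e2 : src (gmul (fpair e)) = lanch x),
    lact (fpair e1) = lact (fpair e2);
  lact1 : forall x (e : src (unt (lanch x)) = lanch x), lact (fpair e) = x;
  ranch_ract : forall x h (e : ranch x = tgt h), ranch (ract (fpair e)) = src h;
  ractA : forall x h h' (e : ranch x = tgt h) (e' : src h = tgt h')
      (e1 : ranch (ract (fpair e)) = tgt h')
      (e2 : ranch x = tgt (gmul (fpair e'))),
    ract (fpair e1) = ract (fpair e2);
  ract1 : forall x (e : ranch x = tgt (unt (ranch x))), ract (fpair e) = x;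
  lanch_ract : forall x h (e : ranch x = tgt h), lanch (ract (fpair e)) = lanch x;
  ranch_lact : forall g x (e : src g = lanch x), ranch (lact (fpair e)) = ranch x;
  act_comm : forall g x h (e : src g = lanch x) (e' : ranch x = tgt h)
      (e1 : ranch (lact (fpair e)) = tgt h)
      (e2 : src g = lanch (ract (fpair e'))),
    ract (fpair e1) = lact (fpair e2)
}.

Section Principal.
Variables (G H : dgroupoid R) (X : bibundle G H).

Lemma rdiv_subproof (xh : fibprod (@ranch G H X) (@tgt R H)) :
  lanch (sval xh).1 = lanch (ract xh).
Proof. by case: xh => -[x h] e /=; rewrite (lanch_ract e). Qed.

(* (x, h) |-> (x, x h) *)
Definition rdiv (xh : fibprod (@ranch G H X) (@tgt R H)) :
    fibprod (@lanch G H X) (@lanch G H X) :=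
  fpair (rdiv_subproof xh).

Lemma ldiv_subproof (gx : fibprod (@src R G) (@lanch G H X)) :
  ranch (lact gx) = ranch (sval gx).2.
Proof. by case: gx => -[g x] e /=; rewrite (ranch_lact e). Qed.

(* (g, x) |-> (g x, x) *)
Definition ldiv (gx : fibprod (@src R G) (@lanch G H X)) :
    fibprod (@ranch G H X) (@ranch G H X) :=
  fpair (ldiv_subproof gx).

Definition right_principal := subduction (@lanch G H X) /\ diffeomorphism rdiv.

Definition left_principal := subduction (@ranch G H X) /\ diffeomorphism ldiv.

Definition biprincipal := right_principal /\ left_principal.

End Principal.

(* The fibre products carry their manifold structures as fibre products in the
   category of manifolds.  These exist because the anchors, the source and the
   target are submersions, and they are the unique manifold structures whose
   smooth parametrisations are those of the product with image in the fibre
   product, which is what arises_from expresses. *)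
Definition lie_biprincipal (G H : lie_groupoid R) (X : bibundle G H) :=
  exists MX : manifold R X,
  [/\ arises_from X MX,
      (forall a, exists x, @lanch G H X x = a) /\
        submersion MX (mobj G) (@lanch G H X),
      (forall b, exists x, @ranch G H X x = b) /\
        submersion MX (mobj H) (@ranch G H X) &
      exists (ML : manifold R (fibprod (@src R G) (@lanch G H X)))
             (MR : manifold R (fibprod (@ranch G H X) (@tgt R H)))
             (Mll : manifold R (fibprod (@lanch G H X) (@lanch G H X)))
             (Mrr : manifold R (fibprod (@ranch G H X) (@ranch G H X))),
        [/\ arises_from _ ML, arises_from _ MR,
            arises_from _ Mll & arises_from _ Mrr] /\
        [/\ msmooth ML MX (@lact G H X),
            msmooth MR MX (@ract G H X),
            mdiffeomorphism MR Mll (@rdiv G H X) &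
            mdiffeomorphism ML Mrr (@ldiv G H X)]].

End Bibundle.

(* Main.v *)
Require Import Defs.
From mathcomp Require Import all_boot all_order all_algebra.
From mathcomp Require Import all_classical all_reals all_analysis.
From HB Require Import structures.
From mathcomp Require Import ring lra.
Import Order.TTheory GRing.Theory Num.Theory.
Import numFieldNormedType.Exports.

(** Say that a smooth map [f : X -> Z] of diffeological spaces is locally
    trivial when near each point of [X] it is the projection of an open subset
    of [Z * R^d] ([trivial_at]).  This notion refers to no chart of [X] or [Z].

    It has four properties.  A submersion of manifolds is locally trivial
    ([submersion_trivial], by the inverse function theorem), and conversely a
    locally trivial map between manifolds is a submersion
    ([trivial_submersion]).  Local triviality passes to pullbacks along smooth
    maps ([trivial_pullback]).  Finally, if [f] is locally trivial and [Z] has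
    charts, so has [X] ([trivial_locally_euclidean]); and a diffeological space
    covered by charts of one dimension is a manifold
    ([locally_euclidean_manifold]).

    Let [X] be a biprincipal bibundle with anchors [l] and [r].  As [l] is a
    subduction it has smooth local sections [sigma], and by principality each
    point [x] with [l x] in the domain of [sigma] is [sigma (l x) h] for a
    unique arrow [h] of [H], which depends smoothly on [x] and has target
    [r (sigma (l x))].  So [l] is locally the pullback of the target map of [H]
    along [r o sigma], and is locally trivial because that target map is a
    submersion ([principal_trivial]).  Exchanging the sides, [r] is locally a
    pullback of the source map of [G].  Hence [X] is a manifold and both anchors
    are submersions; the four fibre products are pullbacks of locally trivial
    maps, thus manifolds.  The smoothness of the actions and of the inverses of
    the two division maps needs no argument, since a diffeologically smooth map
    between manifolds is smooth ([dsmooth_msmooth]). *)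

Set Implicit Arguments.
Unset Strict Implicit.
Unset Printing Implicit Defensive.

Local Open Scope classical_set_scope.
Local Open Scope ring_scope.

(** * Differentials *)

Section Differentials.
Variable R : realType.
Implicit Types V W : normedModType R.

(** A candidate differential is recognised by the usual estimate. *)
Lemma differentiable_epsP V W (f : V -> W) (x : V) (L : {linear V -> W}) :
  continuous L ->
  (forall e : R, 0 < e ->
     \forall h \near (0 : V), `|f (h + x) - f x - L h| <= e * `|h|) ->
  differentiable f x /\ 'd f x = L :> (V -> W).
Proof.
move=> cL fL.
have fo : f \o shift x = cst (f x) + L +o_ (0 : V) id.
  apply/eqaddoP => e e0; near=> h.
  rewrite /cst /= !fctE opprD addrA; near: h; exact: fL.
have dL := diff_unique cL fo.
by split=> //; apply/diff_locallyP; rewrite dL.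
Unshelve. all: by end_near. Qed.

Lemma differentiable_eps V W (f : V -> W) (x : V) :
  differentiable f x -> forall e : R, 0 < e ->
  \forall h \near (0 : V), `|f (h + x) - f x - 'd f x h| <= e * `|h|.
Proof.
move=> /diff_locally /eqaddoP + e e0 => /(_ e e0) fe; near=> h.
have : `|(f \o shift x - (cst (f x) + 'd f x)) h| <= e * `|h| by near: h.
by rewrite /cst /= !fctE opprD addrA.
Unshelve. all: by end_near. Qed.

Lemma near_eq_diff V W (f g : V -> W) (x : V) :
  (\forall y \near x, f y = g y) -> differentiable f x ->
  differentiable g x /\ 'd g x = 'd f x :> (V -> W).
Proof.
move=> fg df; apply: differentiable_epsP; first exact: diff_continuous.
move=> e e0; have fe := differentiable_eps df e0.
have fgx := nbhs_singleton fg.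
have fg0 : \forall h \near (0 : V), f (h + x) = g (h + x).
  by move: fg; rewrite (near_shift 0) subr0.
near=> h.
have <- : f (h + x) = g (h + x) by near: h.
by rewrite -fgx; near: h.
Unshelve. all: by end_near. Qed.

Lemma open_eq_diff V W (U : set V) (f g : V -> W) (x : V) :
  open U -> (forall y, U y -> f y = g y) -> U x -> differentiable f x ->
  differentiable g x /\ 'd g x = 'd f x :> (V -> W).
Proof.
move=> oU fg Ux; apply: near_eq_diff.
by apply: filterS fg _; apply: open_nbhs_nbhs.
Qed.

Lemma diff_idE V (x v : V) : 'd (@id V) x v = v.
Proof.
exact: (congr1 (fun F : V -> V => F v)
  (diff_val (is_diff_def := is_diff_id x))).
Qed.

End Differentials.

(** * Maps of class C^k *)

Section Cdiff.
Variable R : realType.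
Implicit Types V W : normedModType R.

(** The class C^k of [Ck], for maps between arbitrary normed spaces, so as to
    include scalar functions and functions with values in matrices.  Testing the
    differential on each vector is adequate for sources of finite dimension. *)
Fixpoint Cdiff V W (k : nat) (U : set V) (f : V -> W) : Prop :=
  match k with
  | 0%N => forall x, U x -> {for x, continuous f}
  | k'.+1 => (forall x, U x -> differentiable f x) /\
             (forall v : V, Cdiff k' U (fun x => 'd f x v))
  end.

Lemma CkE k m n (U : set 'rV[R]_m) (f : 'rV[R]_m -> 'rV[R]_n) :
  Ck k U f <-> Cdiff k U f.
Proof.
elim: k f => [//|k IH] f /=; split=> -[df cf]; split=> // v; exact/IH.
Qed.

Lemma smooth_onP m n (U : set 'rV[R]_m) (f : 'rV[R]_m -> 'rV[R]_n) :
  smooth_on U f <-> forall k, Cdiff k U f.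
Proof. by split=> sf k; apply/CkE. Qed.

Lemma Cdiff_ext V W k (U : set V) (f g : V -> W) :
  open U -> (forall x, U x -> f x = g x) -> Cdiff k U f -> Cdiff k U g.
Proof.
move=> oU; elim: k f g => [|k IH] f g fg /=.
  move=> cf x Ux.
  have nfg : \forall y \near x, f y = g y.
    by apply: filterS fg _; apply: open_nbhs_nbhs.
  suff : g @ x --> g x by [].
  rewrite -(fg _ Ux).
  by apply: cvg_trans (cf x Ux); apply: near_eq_cvg.
move=> [df cf]; split=> [x Ux|v].
  by have [] := open_eq_diff oU fg Ux (df x Ux).
apply: IH (cf v) => x Ux.
have [_ E] := open_eq_diff oU fg Ux (df x Ux).
exact: (esym (congr1 (fun F : V -> W => F v) E)).
Qed.

Lemma Cdiff_sub V W k (U U' : set V) (f : V -> W) :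
  U' `<=` U -> Cdiff k U f -> Cdiff k U' f.
Proof.
move=> UU; elim: k f => [|k IH] f /=; first by move=> cf x /UU; apply: cf.
by move=> [df cf]; split=> [x /UU|v]; [apply: df|apply: IH].
Qed.

Lemma Cdiff_continuous V W k (U : set V) (f : V -> W) :
  Cdiff k U f -> forall x, U x -> {for x, continuous f}.
Proof.
by case: k => [//|k] [df _] x Ux; apply/differentiable_continuous/df.
Qed.

Lemma CdiffW V W k (U : set V) (f : V -> W) : Cdiff k.+1 U f -> Cdiff k U f.
Proof.
elim: k f => [|k IH] f.
  by move=> cf x Ux; exact: Cdiff_continuous cf x Ux.
by move=> [df cf]; split=> // v; apply: IH.
Qed.

Lemma Cdiff_cst V W k (U : set V) (a : W) : Cdiff k U (fun=> a : W).
Proof.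
elim: k a => [|k IH] a /=; first by move=> x _; apply: cst_continuous.
split=> [x _|v]; first exact: differentiable_cst.
have -> : (fun x => 'd (fun=> a) x v) = (fun=> 0 : W); last exact: IH.
by apply/funext => x; rewrite (diff_cst a x).
Qed.

Lemma Cdiff_lin V W k (U : set V) (L : {linear V -> W}) :
  continuous L -> Cdiff k U L.
Proof.
case: k => [|k] cL /=; first by move=> x _; apply: cL.
split=> [x _|v]; first exact: linear_differentiable.
have -> : (fun x => 'd L x v) = (fun=> L v); last exact: Cdiff_cst.
by apply/funext => x; rewrite diff_lin.
Qed.

Lemma CdiffD V W k (U : set V) (f g : V -> W) : open U ->
  Cdiff k U f -> Cdiff k U g -> Cdiff k U (fun x => f x + g x).
Proof.
move=> oU; elim: k f g => [|k IH] f g /=.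
  by move=> cf cg x Ux; apply: continuousD; [apply: cf|apply: cg].
move=> [df cf] [dg cg]; split=> [x Ux|v].
  by apply: (@differentiableD _ _ _ f g); [apply: df|apply: dg].
apply: Cdiff_ext (IH _ _ (cf v) (cg v)) => // x Ux.
exact: (esym (congr1 (fun F : V -> W => F v) (diffD (df x Ux) (dg x Ux)))).
Qed.

Lemma Cdiff_sum V W k (U : set V) (I : Type) (r : seq I) (f : I -> V -> W) :
  open U -> (forall i, Cdiff k U (f i)) ->
  Cdiff k U (fun x => \sum_(i <- r) f i x).
Proof.
move=> oU cf; elim: r => [|i r IH].
  have -> : (fun x => \sum_(i <- [::]) f i x) = (fun=> 0 : W).
    by apply/funext => x; rewrite big_nil.
  exact: Cdiff_cst.
have -> : (fun x => \sum_(j <- i :: r) f j x) =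
    (fun x => f i x + \sum_(j <- r) f j x).
  by apply/funext => x; rewrite big_cons.
exact: CdiffD.
Qed.

Lemma CdiffM V k (U : set V) (f g : V -> R) : open U ->
  Cdiff k U f -> Cdiff k U g -> Cdiff k U (fun x => f x * g x).
Proof.
move=> oU; elim: k f g => [|k IH] f g.
  by move=> cf cg x Ux; apply: continuousM; [apply: cf|apply: cg].
move=> /[dup] /CdiffW cf0 [df cf] /[dup] /CdiffW cg0 [dg cg]; split=> [x Ux|v].
  by apply: (@differentiableM _ _ f g); [apply: df|apply: dg].
apply: Cdiff_ext (CdiffD oU (IH _ _ cf0 (cg v)) (IH _ _ cg0 (cf v))) => // x Ux.
exact: (esym (congr1 (fun F : V -> R => F v) (diffM (df x Ux) (dg x Ux)))).
Qed.

Lemma Cdiff_prod V k (U : set V) (I : Type) (r : seq I) (f : I -> V -> R) :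
  open U -> (forall i, Cdiff k U (f i)) ->
  Cdiff k U (fun x => \prod_(i <- r) f i x).
Proof.
move=> oU cf; elim: r => [|i r IH].
  have -> : (fun x => \prod_(i <- [::]) f i x) = (fun=> 1 : R).
    by apply/funext => x; rewrite big_nil.
  exact: Cdiff_cst.
have -> : (fun x => \prod_(j <- i :: r) f j x) =
    (fun x => f i x * \prod_(j <- r) f j x).
  by apply/funext => x; rewrite big_cons.
exact: CdiffM.
Qed.

Lemma CdiffV V k (U : set V) (f : V -> R) : open U ->
  (forall x, U x -> f x != 0) -> Cdiff k U f -> Cdiff k U (fun x => (f x)^-1).
Proof.
move=> oU f0; elim: k => [|k IH].
  by move=> cf x Ux; apply: continuousV; [apply: f0|apply: cf].
move=> /[dup] /CdiffW cf0 [df cf]; split=> [x Ux|v].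
  by apply: differentiableV; [apply: df|apply: f0].
have cV := IH cf0.
have c1 : Cdiff k U (fun=> - 1 : R) by exact: Cdiff_cst.
have cd : Cdiff k U (fun x => (f x)^-1 * (f x)^-1 * - 1 * 'd f x v).
  apply: (CdiffM oU _ (cf v)); apply: (CdiffM oU _ c1); exact: CdiffM.
apply: Cdiff_ext cd => // x Ux.
have E := congr1 (fun F : V -> R => F v) (diffV (df x Ux) (f0 x Ux)).
apply: etrans (esym E); rewrite /= -[_ *: _]/(_ * _).
by rewrite expr2 invfM mulrN1.
Qed.

Lemma CdiffZl V W k (U : set V) (f : V -> R) (w : W) : open U ->
  Cdiff k U f -> Cdiff k U (fun x => f x *: w).
Proof.
move=> oU; elim: k f => [|k IH] f.
  by move=> cf x Ux; apply: cvgZr_tmp; apply: cf.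
move=> [df cf]; split=> [x Ux|v].
  by apply: differentiableZl; apply: df.
apply: Cdiff_ext (IH _ (cf v)) => // x Ux.
exact: (esym (congr1 (fun F : V -> W => F v) (diffZl w (df x Ux)))).
Qed.

Lemma Cdiff_lincomp V W W' k (U : set V) (f : V -> W) (L : {linear W -> W'}) :
  open U -> continuous L -> Cdiff k U f -> Cdiff k U (fun x => L (f x)).
Proof.
move=> oU cL; elim: k f => [|k IH] f.
  by move=> cf x Ux; apply: continuous_comp; [apply: cf|apply: cL].
move=> [df cf]; split=> [x Ux|v].
  by apply: differentiable_comp; [apply: df|apply: linear_differentiable].
apply: Cdiff_ext (IH _ (cf v)) => // x Ux.
have E := congr1 (fun F : V -> W' => F v)
  (diff_comp (df x Ux) (linear_differentiable (f x) cL)).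
apply: etrans (esym E) => /=.
exact: (esym (congr1 (fun F : W -> W' => F _) (diff_lin (f x) cL))).
Qed.

(** Since spaces of matrices are of finite dimension, the class of a map with
    values in one is tested on its entries. *)
Lemma Cdiff_mxP V k (U : set V) a b (f : V -> 'M[R]_(a, b)) : open U ->
  Cdiff k U f <-> forall i j, Cdiff k U (fun x => f x i j : R).
Proof.
move=> oU; split=> [cf i j|cf].
  have entry_linear : linear (fun A : 'M[R]_(a, b) => A i j : R).
    by move=> c A B; rewrite !mxE.
  pose L : {linear 'M[R]_(a, b) -> R} := HB.pack
    (fun A : 'M[R]_(a, b) => A i j : R)
    (GRing.isLinear.Build _ _ _ _ _ entry_linear).
  by apply: (Cdiff_lincomp (L := L) oU _ cf); apply: coord_continuous.
have -> : f = fun x => \sum_(i < a) \sum_(j < b) (f x i j *: delta_mx i j).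
  by apply/funext => x; rewrite -matrix_sum_delta.
apply: Cdiff_sum => // i; apply: Cdiff_sum => // j; exact: CdiffZl.
Qed.

Lemma Cdiff_comp V k n a b (U : set V) (U' : set 'rV[R]_n)
    (f : V -> 'rV[R]_n) (g : 'rV[R]_n -> 'M[R]_(a, b)) :
  open U -> open U' -> (forall x, U x -> U' (f x)) ->
  Cdiff k U f -> Cdiff k U' g -> Cdiff k U (fun x => g (f x)).
Proof.
move=> oU oU' UU' cf cg.
suff H (h : 'rV[R]_n -> R) : Cdiff k U' h -> Cdiff k U (fun x => h (f x)).
  apply/(Cdiff_mxP _ _ oU) => i j; apply: (H (fun y => g y i j)).
  exact: ((Cdiff_mxP _ _ oU').1 cg).
move: f h UU' cf {g cg}; elim: k => [|k IH] f g UU'.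
  by move=> cf cg x Ux; apply: continuous_comp; [apply: cf|apply/cg/UU'].
move=> /[dup] /CdiffW cf0 [df cf] [dg cg]; split=> [x Ux|v].
  by apply: differentiable_comp; [apply: df|apply/dg/UU'].
have cpart l : Cdiff k U (fun x =>
    ('d f x v) ord0 l * 'd g (f x) (delta_mx ord0 l)).
  apply: CdiffM => //; last exact: IH (cg _).
  by have := (Cdiff_mxP _ _ oU).1 (cf v) ord0 l.
apply: Cdiff_ext (Cdiff_sum (index_enum 'I_n) oU cpart) => // x Ux.
rewrite (diff_comp (df x Ux) (dg _ (UU' _ Ux))) /=.
rewrite [in RHS](row_sum_delta ('d f x v)) linear_sum.
by apply: eq_bigr => l _; rewrite linearZ.
Qed.

Lemma Cdiff_det V k (U : set V) n (A : V -> 'M[R]_n) : open U ->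
  (forall i j, Cdiff k U (fun x => A x i j : R)) ->
  Cdiff k U (fun x => \det (A x) : R).
Proof.
move=> oU cA; rewrite /determinant.
apply: Cdiff_sum => // s; apply: CdiffM => //; first exact: Cdiff_cst.
by apply: Cdiff_prod => // j.
Qed.

Lemma Cdiff_invmx V k (U : set V) n (A : V -> 'M[R]_n) : open U ->
  (forall x, U x -> A x \in unitmx) ->
  Cdiff k U A -> Cdiff k U (fun x => invmx (A x)).
Proof.
move=> oU uA cA.
have {}cA i j := (Cdiff_mxP _ _ oU).1 cA i j.
apply: (@Cdiff_ext _ _ _ _ (fun x => (\det (A x))^-1 *: \adj (A x))) => //.
  by move=> x Ux; rewrite /invmx uA.
apply/Cdiff_mxP => // i j.
have -> : (fun x => ((\det (A x))^-1 *: \adj (A x)) i j) =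
   (fun x => (\det (A x))^-1 *
      ((-1) ^+ (j + i) * \det (row' j (col' i (A x))))).
  by apply/funext => x; rewrite !mxE.
apply: CdiffM => //.
  apply: CdiffV => //; last exact: Cdiff_det.
  by move=> x Ux; have := uA _ Ux; rewrite unitmxE unitfE.
apply: CdiffM => //; first exact: Cdiff_cst.
apply: Cdiff_det => // i' j'.
have -> : (fun x => row' j (col' i (A x)) i' j') =
   (fun x => A x (lift j i') (lift i j')) by apply/funext => x; rewrite !mxE.
exact: cA.
Qed.

Lemma Cdiff_mulmx V k (U : set V) a b c (A : V -> 'M[R]_(a, b))
    (B : V -> 'M[R]_(b, c)) : open U ->
  Cdiff k U A -> Cdiff k U B -> Cdiff k U (fun x => A x *m B x).
Proof.
move=> oU cA cB; apply/Cdiff_mxP => // i j.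
have -> : (fun x => (A x *m B x) i j) = (fun x => \sum_l A x i l * B x l j).
  by apply/funext => x; rewrite mxE.
apply: Cdiff_sum => // l; apply: CdiffM => //.
  exact: (Cdiff_mxP _ _ oU).1 cA i l.
exact: (Cdiff_mxP _ _ oU).1 cB l j.
Qed.

Lemma Cdiff_row_mx V k (U : set V) a b c (A : V -> 'M[R]_(a, b))
    (B : V -> 'M[R]_(a, c)) : open U ->
  Cdiff k U A -> Cdiff k U B -> Cdiff k U (fun x => row_mx (A x) (B x)).
Proof.
move=> oU cA cB; apply/Cdiff_mxP => // i j.
have -> : (fun x => row_mx (A x) (B x) i j) =
    match fintype.split j with
    | inl l => fun x => A x i l
    | inr l => fun x => B x i l
    end.
  by apply/funext => x; rewrite mxE; case: (fintype.split j).
case: (fintype.split j) => l; first exact: (Cdiff_mxP _ _ oU).1 cA i l.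
exact: (Cdiff_mxP _ _ oU).1 cB i l.
Qed.

End Cdiff.

Section Smooth.
Variable R : realType.

Lemma linear_rV_continuous m (W : normedModType R)
    (f : {linear 'rV[R]_m -> W}) : continuous f.
Proof.
have -> : (f : _ -> _) =
    (fun v => \sum_(j < m) v ord0 j *: f (delta_mx ord0 j)).
  apply/funext => v; rewrite [in LHS](row_sum_delta v) linear_sum.
  by apply: eq_bigr => j _; rewrite linearZ.
have cf : Cdiff 0 setT (fun v : 'rV[R]_m =>
    \sum_(j < m) v ord0 j *: f (delta_mx ord0 j)).
  apply: Cdiff_sum => [|j]; first exact: openT.
  by apply: CdiffZl => [|v _]; [exact: openT|exact: coord_continuous].
by move=> v; exact: cf.
Qed.

Lemma smooth_on_sub m n (U U' : set 'rV[R]_m) (f : 'rV[R]_m -> 'rV[R]_n) :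
  U' `<=` U -> smooth_on U f -> smooth_on U' f.
Proof.
by move=> UU /smooth_onP sf; apply/smooth_onP => k; apply: Cdiff_sub (sf k).
Qed.

Lemma smooth_on_comp l m n (U : set 'rV[R]_l) (U' : set 'rV[R]_m)
    (f : 'rV[R]_l -> 'rV[R]_m) (g : 'rV[R]_m -> 'rV[R]_n) :
  open U -> open U' -> (forall x, U x -> U' (f x)) ->
  smooth_on U f -> smooth_on U' g -> smooth_on U (fun x => g (f x)).
Proof.
move=> oU oU' UU' /smooth_onP sf /smooth_onP sg; apply/smooth_onP => k.
exact: (Cdiff_comp oU oU').
Qed.

Lemma smooth_on_lin m n (U : set 'rV[R]_m) (L : {linear 'rV[R]_m -> 'rV[R]_n}) :
  smooth_on U L.
Proof.
by apply/smooth_onP => k; apply: Cdiff_lin; apply: linear_rV_continuous.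
Qed.

Lemma smooth_on_id m (U : set 'rV[R]_m) : smooth_on U id.
Proof. exact: (@smooth_on_lin _ _ _ idfun). Qed.

Lemma smooth_on_cst m n (U : set 'rV[R]_m) (a : 'rV[R]_n) :
  smooth_on U (fun=> a).
Proof. by apply/smooth_onP => k; apply: Cdiff_cst. Qed.

Lemma smooth_on_mulmxr l m n (U : set 'rV[R]_l) (f : 'rV[R]_l -> 'rV[R]_m)
    (B : 'M[R]_(m, n)) :
  open U -> smooth_on U f -> smooth_on U (fun x => f x *m B).
Proof.
move=> oU /smooth_onP sf; apply/smooth_onP => k.
by apply: Cdiff_mulmx => //; apply: Cdiff_cst.
Qed.

Lemma smooth_on_row_mx l m n (U : set 'rV[R]_l) (f : 'rV[R]_l -> 'rV[R]_m)
    (g : 'rV[R]_l -> 'rV[R]_n) : open U ->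
  smooth_on U f -> smooth_on U g -> smooth_on U (fun x => row_mx (f x) (g x)).
Proof.
move=> oU /smooth_onP sf /smooth_onP sg; apply/smooth_onP => k.
exact: Cdiff_row_mx.
Qed.

Lemma smooth_onD m n (U : set 'rV[R]_m) (f g : 'rV[R]_m -> 'rV[R]_n) :
  open U -> smooth_on U f -> smooth_on U g -> smooth_on U (fun x => f x + g x).
Proof.
move=> oU /smooth_onP sf /smooth_onP sg; apply/smooth_onP => k.
exact: CdiffD.
Qed.

Lemma smooth_on_continuous m n (U : set 'rV[R]_m) (f : 'rV[R]_m -> 'rV[R]_n) :
  smooth_on U f -> forall x, U x -> {for x, continuous f}.
Proof. by move=> /(_ 0%N). Qed.

Lemma smooth_on_differentiable m n (U : set 'rV[R]_m)
    (f : 'rV[R]_m -> 'rV[R]_n) :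
  smooth_on U f -> forall x, U x -> differentiable f x.
Proof. by move=> /(_ 1%N)[]. Qed.

Lemma open_setI_preimage m n (U : set 'rV[R]_m) (V : set 'rV[R]_n)
    (f : 'rV[R]_m -> 'rV[R]_n) :
  open U -> open V -> smooth_on U f -> open (U `&` f @^-1` V).
Proof.
move=> oU oV sf; rewrite openE => x [Ux Vfx]; apply: filterI.
  exact: open_nbhs_nbhs.
apply: (smooth_on_continuous sf Ux); exact: open_nbhs_nbhs.
Qed.

End Smooth.

(** * The inverse function theorem *)

(** Spaces of matrices are Banach spaces. *)
HB.instance Definition _ (R : realType) (m n : nat) :=
  Complete.on 'M[R]_(m, n).

Section InverseFunction.
Variable R : realType.

Lemma mx_entry_le a b (A : 'M[R]_(a, b)) i j : `|A i j| <= `|A|.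
Proof.
rewrite [leRHS]/Num.Def.normr /= mx_normrE.
exact: (@le_bigmax _ _ _ _ (fun ij : 'I_a * 'I_b => `|A ij.1 ij.2|) (i, j)).
Qed.

Lemma mx_norm_leP a b (A : 'M[R]_(a, b)) (c : R) :
  0 <= c -> (forall i j, `|A i j| <= c) -> `|A| <= c.
Proof.
by move=> c0 Ac; rewrite [leLHS]/Num.Def.normr /= mx_normrE; apply: bigmax_le.
Qed.

Lemma convex_ball m (p0 p q : 'rV[R]_m) (r t : R) :
  ball p0 r p -> ball p0 r q -> 0 <= t <= 1 -> ball p0 r (q + t *: (p - q)).
Proof.
rewrite -ball_normE /= => pr qr /andP[t0 t1].
have -> : p0 - (q + t *: (p - q)) = (1 - t) *: (p0 - q) + t *: (p0 - p).
  by apply/rowP => i; rewrite !mxE; ring.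
rewrite (le_lt_trans (ler_normD _ _))// !normrZ !ger0_norm ?subr_ge0//.
have [->|tn0] := eqVneq t 0; first by rewrite subr0 mul1r mul0r addr0.
have tp : 0 < t by rewrite lt_neqAle eq_sym tn0.
have h1 : (1 - t) * `|p0 - q| <= (1 - t) * r 
  by apply: ler_wpM2l; [rewrite subr_ge0|exact: ltW].
have h2 : t * `|p0 - p| < t * r by rewrite ltr_pM2l.
lra.
Qed.

(** The mean value inequality, from bounds on the partial derivatives. *)
Lemma mean_value_le m n (h : 'rV[R]_m -> 'rV[R]_n) (p0 : 'rV[R]_m) (r c : R) :
  0 <= c ->
  (forall p, ball p0 r p -> differentiable h p) ->
  (forall p, ball p0 r p ->
     forall j, `|'d h p (delta_mx ord0 j)| <= c) ->
  forall p q, ball p0 r p -> ball p0 r q ->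
    `|h p - h q| <= m%:R * c * `|p - q|.
Proof.
move=> c0 dh hc p q pr qr; set w := p - q.
have dhw x : ball p0 r x -> `|'d h x w| <= m%:R * c * `|w|.
  move=> xr; rewrite [in leLHS](row_sum_delta w) linear_sum.
  apply: le_trans (ler_norm_sum _ _ _) _.
  have <- : \sum_(j < m) c * `|w| = m%:R * c * `|w|.
    by rewrite sumr_const card_ord -mulrA mulr_natl.
  apply: ler_sum => j _; rewrite linearZ normrZ mulrC.
  by apply: ler_pM => //; [exact: hc|exact: mx_entry_le].
apply: mx_norm_leP => [|i j]; first by rewrite !mulr_ge0.
rewrite ord1 {i}.
pose gam := fun t : R => q + t *: w.
have gamr t : 0 <= t <= 1 -> ball p0 r (gam t) by exact: convex_ball.
have dgam (t : R) : differentiable gam t /\ 'd gam t = *:%R^~ w :> (R -> _).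
  have D : is_diff t (cst q + *:%R^~ w) (0 + *:%R^~ w) by exact: is_diffD.
  split; first by exact: (@ex_diff _ _ _ _ _ _ _ D).
  have -> : gam = cst q + *:%R^~ w by apply/funext.
  by rewrite diff_val add0r.
have dhg (t : R) : 0 <= t <= 1 -> differentiable (h \o gam) t /\
    'd (h \o gam) t 1 = 'd h (gam t) w.
  move=> t01; have [d1 d2] := dgam t; have d3 := dh _ (gamr _ t01).
  split; first exact: differentiable_comp.
  by rewrite (diff_comp d1 d3) /= d2 scale1r.
have der (t : R) : 0 <= t <= 1 ->
    is_derive t 1 (fun t => (h \o gam) t ord0 j) ('d h (gam t) w ord0 j).
  move=> t01; have [d1 d2] := dhg t t01.
  have d3 : derivable (h \o gam) t 1 by exact: diff_derivable.
  apply: DeriveDef; first exact: (derivable_mxP _ _ _).1 d3 ord0 j.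
  have := derive_mx d3 => /(congr1 (fun M : 'rV_n => M ord0 j)).
  by rewrite mxE (deriveE _ d1) d2 => <-.
have [||t t01] := @MVT_segment R (fun t => (h \o gam) t ord0 j)
    (fun t => 'd h (gam t) w ord0 j) 0 1 ler01.
- by move=> t; rewrite in_itv /= => /andP[t0 t1]; apply: der; rewrite !ltW.
- apply: derivable_within_continuous => t; rewrite in_itv /= => t01.
  by have [] := der t t01.
have wE : q + w = p by rewrite /w addrC subrK.
rewrite subr0 mulr1 /gam /= scale1r scale0r addr0 wE => E.
rewrite !mxE E; apply: le_trans (mx_entry_le _ _ _) _; apply: dhw.
by apply: gamr; move: t01; rewrite in_itv.
Qed.

Section Local.
Variables (m : nat) (O : set 'rV[R]_m) (Phi : 'rV[R]_m -> 'rV[R]_m).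
Variable p0 : 'rV[R]_m.
Hypotheses (oO : open O) (Op0 : O p0) (sPhi : smooth_on O Phi).
Hypothesis dPhi0 : forall v, 'd Phi p0 v = v.

(** The jacobian matrix is of every class C^k. *)
Lemma smooth_jacobian k : Cdiff k O (fun p => 'J Phi p).
Proof.
apply/Cdiff_mxP => // i j.
have -> : (fun p => 'J Phi p i j) =
   (fun p => 'd Phi p (delta_mx ord0 i) ord0 j).
  by apply/funext => p; rewrite /jacobian /lin1_mx mxE.
have /smooth_onP/(_ k.+1)[_ /(_ (delta_mx ord0 i))] := sPhi.
by move=> /(Cdiff_mxP _ _ oO); apply.
Qed.

Lemma near_unit_jacobian : \forall p \near p0, 'J Phi p \in unitmx.
Proof.
have cJ i j := (Cdiff_mxP _ _ oO).1 (smooth_jacobian 0) i j.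
have cdet := Cdiff_det oO cJ.
have J0 : 'J Phi p0 = 1%:M.
  apply/matrixP => i j; rewrite /jacobian /lin1_mx mxE dPhi0 !mxE.
  by rewrite eqxx /= eq_sym.
have : \forall p \near p0, \det ('J Phi p) != 0.
  apply: (@cvgr_neq0 _ _ _ _ _ _ _ (cdet _ Op0)).
  by rewrite J0 det1 oner_neq0.
by apply: filterS => p; rewrite unitmxE unitfE.
Qed.

(** Near [p0] the map [Phi] is the identity up to a contraction. *)
Lemma near_contraction : exists2 r : R, 0 < r &
  forall p, ball p0 r p -> [/\ O p, 'J Phi p \in unitmx &
    forall q, ball p0 r q ->
      `|(p - Phi p) - (q - Phi q)| <= 2^-1 * `|p - q|].
Proof.
(* chosen so that m * c <= 1/2 in the mean value inequality *)
pose c : R := (2 * m.+1%:R)^-1.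
have c0 : 0 < c by rewrite invr_gt0 mulr_gt0.
have dP p : O p -> differentiable Phi p by exact: smooth_on_differentiable.
have nearP (f : 'rV[R]_m -> 'rV[R]_m) (v : 'rV[R]_m) :
    {for p0, continuous f} -> f p0 = v -> \forall p \near p0, `|v - f p| < c.
  by move=> cf <-; exact: ((cvgrPdist_lt f (f p0)).1 cf c c0).
have cP j : \forall p \near p0,
    `|delta_mx ord0 j - 'd Phi p (delta_mx ord0 j)| < c.
  have /smooth_onP/(_ 1%N)[_ /(_ (delta_mx ord0 j)) cd] := sPhi.
  exact: (nearP _ _ (cd _ Op0) (dPhi0 _)).
have : \forall p \near p0, [/\ O p, 'J Phi p \in unitmx &
    forall j, `|delta_mx ord0 j - 'd Phi p (delta_mx ord0 j)| < c].
  near=> p; split; near: p.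
  - exact: open_nbhs_nbhs.
  - exact: near_unit_jacobian.
  - by apply: filter_forall => i; exact: cP.
move=> /nbhs_ballP[r /= r0 rP]; exists r => // p pr.
have [Op Jp _] := rP _ pr; split=> // q qr.
pose h : 'rV[R]_m -> 'rV[R]_m := id - Phi.
have dh x : ball p0 r x -> differentiable h x.
  by move=> /rP[Ox _ _]; apply: differentiableB => //; exact: dP.
have hE x v : ball p0 r x -> 'd h x v = v - 'd Phi x v.
  move=> /rP[Ox _ _].
  have did : differentiable (@id 'rV[R]_m) x by exact: ex_diff.
  have E := congr1 (fun F : 'rV[R]_m -> 'rV[R]_m => F v) (diffB did (dP x Ox)).
  exact: etrans E (congr1 (fun u => u - 'd Phi x v) (diff_idE x v)).
have le_hc x : ball p0 r x -> forall j, `|'d h x (delta_mx ord0 j)| <= c.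
  by move=> xr j; rewrite hE //; have [_ _ /(_ j)/ltW] := rP _ xr.
apply: le_trans (mean_value_le (ltW c0) dh le_hc pr qr) _.
rewrite ler_wpM2r // /c invfM mulrCA ler_piMr // ler_pdivrMr //.
by rewrite mul1r ler_nat.
Unshelve. all: by end_near. Qed.

End Local.

(** A perturbation of the identity by a contraction is onto near the image of
    the centre, by the fixed point theorem. *)
Lemma contraction_surjective m (Phi : 'rV[R]_m -> 'rV[R]_m) (p0 : 'rV[R]_m)
    (s : R) : 0 < s ->
  (forall p q, `|p0 - p| <= s -> `|p0 - q| <= s ->
      `|(p - Phi p) - (q - Phi q)| <= 2^-1 * `|p - q|) ->
  forall y, `|Phi p0 - y| <= s / 2 -> exists2 p, `|p0 - p| <= s & Phi p = y.
Proof.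
move=> s0 hc y ys.
pose B := closed_ball p0 s : set 'rV[R]_m.
have BE p : B p <-> `|p0 - p| <= s by rewrite /B closed_ballE.
(* the fixed points of T are the solutions of Phi p = y *)
pose T p := y + (p - Phi p).
have TB : {homo T : p / B p >-> B p}.
  move=> p /BE ps; apply/BE; rewrite /T.
  have -> : p0 - (y + (p - Phi p)) =
      (Phi p0 - y) + ((p0 - Phi p0) - (p - Phi p)).
    by apply/rowP => i; rewrite !mxE; ring.
  apply: le_trans (ler_normD _ _) _.
  have := hc p0 p; rewrite subrr normr0 => /(_ (ltW s0) ps) h.
  lra.
have cT : is_contraction (mkfun_fun TB).
  exists (2^-1%:nng); split => /=; first by rewrite invf_lt1 // ltr1n.
  move=> [p q] [/= /BE ps /BE qs].
  have -> : mkfun_fun TB p - mkfun_fun TB q = (p - Phi p) - (q - Phi q).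
    by rewrite /= /mkfun /T; apply/rowP => i; rewrite !mxE; ring.
  exact: hc.
have B0 : B !=set0 by exists p0; apply/BE; rewrite subrr normr0 ltW.
have [p /BE ps Tp] := banach_fixed_point cT (@closed_ball_closed _ _ p0 s) B0.
exists p => //; move: Tp; rewrite /= /mkfun /T.
move=> /(congr1 (fun v => Phi p - p + v)).
rewrite subrK => ->.
by apply/rowP => i; rewrite !mxE; ring.
Qed.

Section Inverse.
Variables (m : nat) (O : set 'rV[R]_m) (Phi : 'rV[R]_m -> 'rV[R]_m).
Variable p0 : 'rV[R]_m.
Hypotheses (oO : open O) (Op0 : O p0) (sPhi : smooth_on O Phi).

(** A Lipschitz local inverse is differentiable, with the inverse
    differential. *)
Lemma differentiable_inverse (V : set 'rV[R]_m) (Psi : 'rV[R]_m -> 'rV[R]_m)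
    (C : R) : open V -> 0 < C ->
  (forall q, V q ->
     [/\ O (Psi q), Phi (Psi q) = q & 'J Phi (Psi q) \in unitmx]) ->
  (forall q q', V q -> V q' -> `|Psi q - Psi q'| <= C * `|q - q'|) ->
  forall q, V q -> differentiable Psi q /\
    forall v, 'd Psi q v = v *m invmx ('J Phi (Psi q)).
Proof.
move=> oV C0 VP lip q Vq; have [Op Pq uJ] := VP q Vq.
set p := Psi q in Op Pq uJ *; set N := invmx ('J Phi p).
pose L : {linear 'rV[R]_m -> 'rV[R]_m} := mulmxr N.
have cL : continuous L by exact: linear_rV_continuous.
have [k k0 Lk] := linear_lipschitz cL.
have dP : differentiable Phi p := smooth_on_differentiable sPhi Op.
suff [dPsi E] : differentiable Psi q /\ 'd Psi q = L :> (_ -> _).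
  by split=> // v; rewrite E.
apply: differentiable_epsP => // e e0.
(* |L v| <= k |v| and |u| <= C |h| below turn this constant into e *)
have e1 : 0 < e / (k * C) by rewrite divr_gt0 // mulr_gt0.
have := differentiable_eps dP e1.
move=> /nbhs_ballP[d /= d0 dPe].
have V0 : \forall h \near (0 : 'rV[R]_m), V (h + q).
  have : \forall y \near q, V y by exact: open_nbhs_nbhs.
  by rewrite (near_shift 0) subr0.
have h0 : \forall h \near (0 : 'rV[R]_m), `|h| < d / C.
  apply/nbhs_ballP; exists (d / C) => /=; first exact: divr_gt0.
  by move=> h; rewrite -ball_normE /= sub0r normrN.
near=> h.
have Vh : V (h + q) by near: h.
have hd : `|h| < d / C by near: h.
have [_ Pqh _] := VP _ Vh.
set u := Psi (h + q) - p.
have uh : `|u| <= C * `|h|.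
  by apply: le_trans (lip _ _ Vh Vq) _; rewrite addrK.
have ud : `|u| < d.
  by apply: le_lt_trans uh _; rewrite mulrC -ltr_pdivlMr.
have up : u + p = Psi (h + q) by rewrite subrK.
have := dPe u; rewrite -ball_normE /= sub0r normrN => /(_ ud).
rewrite up Pqh Pq addrK => hle.
have dE : 'd Phi p u = u *m 'J Phi p by rewrite /jacobian mul_rV_lin1.
have -> : u - L h = - L (h - 'd Phi p u).
  by rewrite linearB opprB dE /= /N mulmxK.
rewrite normrN; apply: le_trans (Lk _) _.
apply: (@le_trans _ _ (k * (e / (k * C) * (C * `|h|)))).
  rewrite ler_pM2l //; apply: le_trans hle _; rewrite ler_pM2l //.
rewrite le_eqVlt; apply/orP; left; apply/eqP; field.
by rewrite !gt_eqF.
Unshelve. all: by end_near. Qed.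

(** The formula for the differential of the inverse map raises its class from
    C^k to C^(k+1). *)
Lemma smooth_inverse (V : set 'rV[R]_m) (Psi : 'rV[R]_m -> 'rV[R]_m)
    (C : R) : open V -> 0 < C ->
  (forall q, V q ->
     [/\ O (Psi q), Phi (Psi q) = q & 'J Phi (Psi q) \in unitmx]) ->
  (forall q q', V q -> V q' -> `|Psi q - Psi q'| <= C * `|q - q'|) ->
  smooth_on V Psi.
Proof.
move=> oV C0 VP lip; have dPsi := differentiable_inverse oV C0 VP lip.
apply/smooth_onP; elim=> [|k IH].
  by move=> q Vq; apply: differentiable_continuous; have [] := dPsi q Vq.
split=> [q /dPsi[]//|v].
pose O' := O `&` [set p | 'J Phi p \in unitmx].
have oO' : open O'.
  have -> : O' = O `&` [set p | \det ('J Phi p) != 0].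
    by apply/seteqP; split=> p [Op Jp]; split=> //; move: Jp;
      rewrite /mkset unitmxE unitfE.
  rewrite openE => p [Op dp]; apply: filterI; first exact: open_nbhs_nbhs.
  have cJ i j := (Cdiff_mxP _ _ oO).1 (smooth_jacobian oO sPhi 0) i j.
  have cdet : {for p, continuous (fun p => \det ('J Phi p))}.
    exact: (Cdiff_det oO cJ _ Op).
  by apply: (@cvgr_neq0 _ _ _ _ _ _ _ cdet); exact: dp.
have cN : Cdiff k O' (fun p => v *m invmx ('J Phi p)).
  apply: Cdiff_mulmx => //; first exact: Cdiff_cst.
  apply: Cdiff_invmx => //; first by move=> p [].
  by apply: Cdiff_sub (smooth_jacobian oO sPhi k) => p [].
have VO' q : V q -> O' (Psi q) by move=> /VP[].
apply: Cdiff_ext (Cdiff_comp oV oO' VO' IH cN) => // q Vq.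
by have [_ ->] := dPsi q Vq.
Qed.

(** The inverse function theorem, at a point where the differential is the
    identity. *)
Theorem inverse_function : (forall v, 'd Phi p0 v = v) ->
  exists (U V : set 'rV[R]_m) (Psi : 'rV[R]_m -> 'rV[R]_m),
    [/\ open U, U p0, U `<=` O, open V & smooth_on V Psi] /\
    (forall p, U p -> V (Phi p) /\ Psi (Phi p) = p) /\
    (forall q, V q -> U (Psi q) /\ Phi (Psi q) = q).
Proof.
move=> d1; have [r r0 rP] := near_contraction oO Op0 sPhi d1.
pose s := r / 2; have s0 : 0 < s by rewrite divr_gt0.
have sr (p : 'rV[R]_m) : `|p0 - p| <= s -> ball p0 r p.
  rewrite -ball_normE /= => /le_lt_trans; apply.
  by rewrite /s ltr_pdivrMr // ltr_pMr // ltr1n.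
pose V := ball (Phi p0) (s / 2) : set 'rV[R]_m.
have surj (y : 'rV[R]_m) : V y -> exists p : 'rV[R]_m, ball p0 r p /\ Phi p = y.
  move=> Vy; have ys : `|Phi p0 - y| <= s / 2.
    by move: Vy; rewrite /V -ball_normE => /ltW.
  have [p ps Py] := contraction_surjective s0
    (fun p q ps qs => let: And3 _ _ h := rP p (sr p ps) in h q (sr q qs)) ys.
  by exists p; split; [apply: sr|].
have lip (p q : 'rV[R]_m) : ball p0 r p -> ball p0 r q ->
    `|p - q| <= 2 * `|Phi p - Phi q|.
  move=> pr qr; have [_ _ /(_ q qr)] := rP p pr.
  have : `|p - q| <= `|(p - Phi p) - (q - Phi q)| + `|Phi p - Phi q|.
    apply: le_trans (ler_normD _ _); rewrite le_eqVlt; apply/orP; left.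
    by apply/eqP; congr (`|_|); apply/rowP => i; rewrite !mxE; ring.
  by move=> h1 h2; lra.
pose U := ball p0 r `&` Phi @^-1` V.
have [Psi PsiP] : exists Psi, forall q, V q ->
    ball p0 r (Psi q) /\ Phi (Psi q) = q.
  have /choice[Psi PsiP] : forall q, exists p : 'rV[R]_m, V q ->
      ball p0 r p /\ Phi p = q.
    move=> q; have [/surj[p pP]|nV] := pselect (V q); first by exists p.
    by exists p0 => /nV.
  by exists Psi.
have oV : open V by exact: ball_open.
have brO : ball p0 r `<=` O by move=> p /rP[].
exists U, V, Psi; split; first split.
- apply: open_setI_preimage => //; first exact: ball_open.
  exact: smooth_on_sub sPhi.
- by split; [exact: ballxx|apply: ballxx; rewrite divr_gt0].
- by move=> p [/brO].
- exact: oV.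
- apply: (smooth_inverse oV (ltr0n _ 2)) => [q Vq|q q' Vq Vq'].
    by have [pr Pq] := PsiP q Vq; have [Op Jp _] := rP _ pr.
  have [pr Pq] := PsiP q Vq; have [pr' Pq'] := PsiP q' Vq'.
  by apply: le_trans (lip _ _ pr pr') _; rewrite Pq Pq'.
split=> [p [pr Vp]|q Vq].
  split=> //; have [qr Pq] := PsiP _ Vp.
  apply/eqP; rewrite -subr_eq0 -normr_le0.
  by apply: le_trans (lip _ _ qr pr) _; rewrite Pq subrr normr0 mulr0.
by have [qr Pq] := PsiP _ Vq; split=> //; split=> //; rewrite /preimage /= Pq.
Qed.

End Inverse.
End InverseFunction.

(** * Diffeological charts *)

Section Charts.
Variable R : realType.
Implicit Types X Y Z : dspace R.

Lemma plot_sub X n (U V : set 'rV[R]_n) (p : 'rV[R]_n -> X) :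
  plot U p -> open V -> V `<=` U -> plot V p.
Proof.
move=> pU oV VU; apply: (@plot_ext _ _ _ _ (p \o id)) => //.
by apply: plot_comp pU oV _ VU; apply: smooth_on_id.
Qed.

Lemma plot_set0 X n (p : 'rV[R]_n -> X) : plot set0 p.
Proof. by apply: (plot_ext (plot_cst (p 0) open0)) => x. Qed.

(** The open sets of the topology generated by the plots. *)
Definition dopen X (A : set X) :=
  forall n (U : set 'rV[R]_n) p, plot U p -> open (U `&` p @^-1` A).

(** A chart that is a diffeomorphism from an open subspace of [X] onto an open
    set of R^n, for the diffeology of [X]. *)
Definition dchart X n (c : chart R X n) :=
  [/\ plot (cmap c @` cdom c) (cinv c), dopen (cdom c) &
      forall k (U : set 'rV[R]_k) p, plot U p ->
        smooth_on (U `&` p @^-1` cdom c) (cmap c \o p)].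

(** The space [X] is covered by diffeological charts of dimension [n]. *)
Definition locally_euclidean X n :=
  forall x : X, exists2 c : chart R X n, dchart c & cdom c x.

Lemma cinv_image X n (c : chart R X n) v :
  (cmap c @` cdom c) v -> cdom c (cinv c v) /\ cmap c (cinv c v) = v.
Proof. by move=> [x cx <-]; rewrite cmapK. Qed.

(** The charts of a manifold are diffeological charts. *)
Lemma arises_dchart X (M : manifold R X) c :
  arises_from X M -> atlas c -> @dchart X (mdim M) c.
Proof.
move=> XM Mc; split.
- apply/XM; split=> [|c' Mc']; first exact: cmap_open.
  have [oc sc] := atlas_compat Mc Mc'.
  suff -> : cmap c @` cdom c `&` cinv c @^-1` cdom c' =
      cmap c @` (cdom c `&` cdom c') by [].
  apply/seteqP; split=> v.
    by move=> [/cinv_image[cv vE] c'v]; exists (cinv c v).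
  by move=> [x [cx c'x] <-]; split; [exists x|rewrite /preimage /= cmapK].
- by move=> n U p /XM[_ /(_ c Mc)[]].
- by move=> n U p /XM[_ /(_ c Mc)[]].
Qed.

Lemma arises_locally_euclidean X (M : manifold R X) :
  arises_from X M -> locally_euclidean X (mdim M).
Proof.
move=> XM x; have [c Mc cx] := atlas_cover M x.
by exists c => //; apply: arises_dchart.
Qed.

(** Conversely all the diffeological charts of a fixed dimension form an
    atlas. *)
Lemma locally_euclidean_manifold X n : locally_euclidean X n ->
  exists M : manifold R X, arises_from X M.
Proof.
move=> Xn.
have compat (c c' : chart R X n) : dchart c -> dchart c' ->
    open (cmap c @` (cdom c `&` cdom c')) /\
    smooth_on (cmap c @` (cdom c `&` cdom c')) (cmap c' \o cinv c).
  move=> [pc _ _] [_ oc' sc'].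
  have -> : cmap c @` (cdom c `&` cdom c') =
      cmap c @` cdom c `&` cinv c @^-1` cdom c'.
    apply/seteqP; split=> v; last first.
      by move=> [/cinv_image[cv vE] c'v]; exists (cinv c v).
    by move=> [x [cx c'x] <-]; split; [exists x|rewrite /preimage /= cmapK].
  by split; [exact: oc' pc|exact: sc' pc].
pose M := @Manifold R X n [set c | dchart c] Xn compat.
exists M => k U p; split=> [pU|[oU Up]].
  split=> [|c [_ oc sc]]; first exact: plot_open pU.
  by split; [exact: oc|exact: sc].
apply: (@plot_local _ _ _ _ _ {c : chart R X n | dchart c}
   (fun c => U `&` p @^-1` cdom (sval c))).
- apply/seteqP; split=> [x Ux|x [c _ []//]].
  by have [c dc cx] := Xn (p x); exists (exist _ c dc).
- by move=> [c dc]; have [] := Up c dc.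
move=> [c dc] /=; have [oc sc] := Up c dc; have [pc _ _] := dc.
have := plot_comp pc oc sc.
have H : forall x, (U `&` p @^-1` cdom c) x ->
    (cmap c @` cdom c) ((cmap c \o p) x).
  by move=> x [Ux cx]; exists (p x).
move=> /(_ H) pl; apply: plot_ext pl _ => x [Ux cx] /=.
by rewrite cmapK.
Qed.

(** Between manifolds, diffeological smoothness is smoothness: the inverse of a
    chart of the source is a plot. *)
Lemma dsmooth_msmooth X Y (M : manifold R X) (N : manifold R Y) (f : X -> Y) :
  arises_from X M -> arises_from Y N -> dsmooth f -> msmooth M N f.
Proof.
move=> XM YN sf c c' Mc Nc'.
have [pc _ _] := arises_dchart XM Mc.
have [_ oc' sc'] := arises_dchart YN Nc'.
have pf := sf _ _ _ pc.
have -> : cmap c @` (cdom c `&` f @^-1` cdom c') =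
    cmap c @` cdom c `&` (f \o cinv c) @^-1` cdom c'.
  apply/seteqP; split=> v; last first.
    by move=> [/cinv_image[cv vE] c'v]; exists (cinv c v).
  by move=> [x [cx c'x] <-]; split; [exists x|rewrite /preimage /= cmapK].
by split; [exact: oc' pf|exact: sc' pf].
Qed.

Lemma diffeomorphism_mdiffeomorphism X Y (M : manifold R X) (N : manifold R Y)
    (f : X -> Y) :
  arises_from X M -> arises_from Y N -> diffeomorphism f ->
  mdiffeomorphism M N f.
Proof.
move=> XM YN [sf [f' [sf' fK f'K]]]; split; first exact: dsmooth_msmooth.
by exists f'; split=> //; exact: dsmooth_msmooth.
Qed.

End Charts.

(** * Smooth maps that are locally projections of products *)

Section Box.
Variable R : realType.
Implicit Types X Y Z : dspace R.

(** A trivialisation of [f] on the open set [D]: the map [x |-> (f x, a x)] is a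
    diffeomorphism of [D] onto the open set [E] of [Z * R^d], with inverse
    [rho].  The values of [a] outside [D] and of [rho] outside [E] are
    irrelevant. *)
Record trivialisation X Z (f : X -> Z) d (D : set X) (a : X -> 'rV[R]_d)
    (E : Z -> 'rV[R]_d -> Prop) (rho : Z -> 'rV[R]_d -> X) : Prop := Triv {
  triv_open : dopen D;
  triv_smooth : forall n (U : set 'rV[R]_n) p, plot U p ->
    smooth_on (U `&` p @^-1` D) (a \o p);
  triv_in : forall x, D x -> E (f x) (a x);
  trivK : forall x, D x -> rho (f x) (a x) = x;
  triv_out : forall z u, E z u ->
    [/\ D (rho z u), f (rho z u) = z & a (rho z u) = u];
  triv_plot : forall n (U : set 'rV[R]_n) p w, plot U p -> smooth_on U w ->
    open (U `&` [set t | E (p t) (w t)]) /\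
    plot (U `&` [set t | E (p t) (w t)]) (fun t => rho (p t) (w t))
}.

(** Near [x], the map [f] is the projection of a product with R^d. *)
Definition trivial_at X Z (f : X -> Z) d (x : X) :=
  exists D a E rho, @trivialisation X Z f d D a E rho /\ D x.

(** Over a chart of the base, a trivialisation is a chart of the source. *)
Lemma trivial_dchart X Z (f : X -> Z) d x k (c : chart R Z k) :
  dsmooth f -> trivial_at f d x -> dchart c -> cdom c (f x) ->
  exists2 c' : chart R X (k + d), dchart c' & cdom c' x.
Proof.
move=> sf [D [a [E [rho [T Dx]]]]] [pc oc sc] cfx.
pose J := cmap c @` cdom c.
pose U0 : set 'rV[R]_(k + d) := setT `&` lsubmx @^-1` J.
have oU0 : open U0.
  apply: open_setI_preimage => //; first exact: openT.
    exact: cmap_open.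
  exact: smooth_on_lin.
have p0 : plot U0 (cinv c \o lsubmx).
  apply: plot_comp pc oU0 _ _; last by move=> w [].
  exact: smooth_on_lin.
have [oI pI] := triv_plot T p0 (@smooth_on_lin _ _ _ U0 rsubmx).
pose D' := D `&` f @^-1` cdom c.
pose cm y := row_mx (cmap c (f y)) (a y).
pose ci (w : 'rV[R]_(k + d)) := rho (cinv c (lsubmx w)) (rsubmx w).
have cmD : cm @` D' =
    U0 `&` [set w | E ((cinv c \o lsubmx) w) (rsubmx w)].
  apply/seteqP; split=> w.
    move=> [y [Dy cy] <-]; rewrite /cm; split.
      by split=> //; rewrite /preimage /= row_mxKl; exists (f y).
    by rewrite /= row_mxKl row_mxKr cmapK //; exact: triv_in T _ Dy.
  move=> [[_ [z cz zw]]] /=; rewrite -zw cmapK // => Ew.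
  have [Dr fr ar] := triv_out T Ew.
  exists (rho z (rsubmx w)); first by split=> //; rewrite /preimage /= fr.
  by rewrite /cm fr ar zw hsubmxK.
have ocm : open (cm @` D') by rewrite cmD.
have cmK y : D' y -> ci (cm y) = y.
  move=> [Dy cy]; rewrite /ci /cm row_mxKl row_mxKr cmapK //.
  exact: trivK T _ Dy.
exists (Chart ocm cmK) => //; split => /=.
- by rewrite cmD.
- move=> n U p pU.
  have -> : U `&` p @^-1` D' =
      (U `&` p @^-1` D) `&` (U `&` (f \o p) @^-1` cdom c).
    by apply/seteqP; split=> t [] => [Ut [Dt ct]|[Ut Dt] [_ ct]].
  by apply: openI; [exact: triv_open T _ _ _ pU|exact: oc (sf _ _ _ pU)].
- move=> n U p pU.
  have oD := triv_open T pU; have oc' := oc _ _ _ (sf _ _ _ pU).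
  have -> : U `&` p @^-1` D' =
      (U `&` p @^-1` D) `&` (U `&` (f \o p) @^-1` cdom c).
    by apply/seteqP; split=> t [] => [Ut [Dt ct]|[Ut Dt] [_ ct]].
  apply: smooth_on_row_mx; first exact: openI.
    by apply: smooth_on_sub (sc _ _ _ (sf _ _ _ pU)) => t [].
  by apply: smooth_on_sub (triv_smooth T pU) => t [].
Qed.

Lemma trivial_locally_euclidean X Z (f : X -> Z) d k :
  dsmooth f -> (forall x, trivial_at f d x) -> locally_euclidean Z k ->
  locally_euclidean X (k + d).
Proof.
move=> sf tf Zk x; have [c dc cx] := Zk (f x).
exact: trivial_dchart (tf x) dc cx.
Qed.

(** Trivialisations give smooth local sections through every point, hence a
    surjective differential. *)
Lemma trivial_submersion X Z (M : manifold R X) (N : manifold R Z) (f : X -> Z)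
    d : arises_from X M -> arises_from Z N -> dsmooth f ->
  (forall x, trivial_at f d x) -> submersion M N f.
Proof.
move=> XM ZN sf tf; have mf := dsmooth_msmooth XM ZN sf; split=> //.
move=> c c' x Mc Nc' cx c'x w.
have [D [a [E [rho [T Dx]]]]] := tf x.
have [pc' _ _] := arises_dchart ZN Nc'.
have [_ oc sc] := arises_dchart XM Mc.
have [oU1 pU1] := triv_plot T pc' (smooth_on_cst (cmap c' @` cdom c') (a x)).
set U1 := _ `&` _ in oU1 pU1.
pose tau t := rho (cinv c' t) (a x).
pose t0 := cmap c' (f x).
have U1t0 : U1 t0.
  split; first by exists (f x).
  by rewrite /= cmapK //; exact: triv_in T _ Dx.
have taut0 : tau t0 = x by rewrite /tau cmapK // (trivK T Dx).
have oU2 := oc _ _ _ pU1; have sU2 := sc _ _ _ pU1.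
set U2 := _ `&` _ in oU2 sU2.
have U2t0 : U2 t0 by split=> //; rewrite /preimage /= -/(tau t0) taut0.
have [oO sO] := mf _ _ Mc Nc'; set O := _ @` _ in oO sO.
set F := _ \o cinv c in sO *.
pose g := cmap c \o tau.
have gt0 : g t0 = cmap c x by rewrite /g /= taut0.
have dg : differentiable g t0 := smooth_on_differentiable sU2 U2t0.
have dF : differentiable F (g t0).
  by rewrite gt0; apply: smooth_on_differentiable sO _ _; exists x.
have Fg t : U2 t -> t = F (g t).
  move=> [[Jt Et] ct]; rewrite /F /g /= cmapK //.
  have [_ -> _] := triv_out T Et.
  by have [] := cinv_image Jt.
have did : differentiable (@id 'rV[R]_(mdim N)) t0 by exact: ex_diff.
have [_ E1] := @open_eq_diff _ _ _ U2 id (F \o g) t0 oU2 Fg U2t0 did.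
have E3 := congr1 (fun F : 'rV[R]_(mdim N) -> 'rV[R]_(mdim N) => F w) E1.
have E4 := congr1 (fun F : 'rV[R]_(mdim N) -> 'rV[R]_(mdim N) => F w)
  (diff_comp dg dF).
exists ('d g t0 w); rewrite -gt0.
exact: etrans (esym E4) (etrans E3 (diff_idE t0 w)).
Qed.

(** A matrix of full column rank completes to an invertible square matrix; the
    inverse is given by its blocks of rows. *)
Lemma row_full_complement m k (A : 'M[R]_(m, k)) : row_full A ->
  exists (B : 'M[R]_(m, m - k)) (T1 : 'M[R]_(k, m)) (T2 : 'M[R]_(m - k, m)),
    [/\ A *m T1 + B *m T2 = 1%:M, T1 *m A = 1%:M, T2 *m A = 0,
        T1 *m B = 0 & T2 *m B = 1%:M].
Proof.
move=> fA; have km : (k <= m)%N by rewrite -(eqP fA) rank_leq_row.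
move: (m - k)%N (subnKC km) => d e.
case: m / e A fA {km} => A fA.
have := mulmx_ebase A; rewrite (eqP fA).
move: (col_ebase_unit A) (row_ebase_unit A).
move: (col_ebase A) (row_ebase A) => L Q uL uQ.
rewrite pid_mx_col.
move=> <-.
exists (L *m col_mx 0 1%:M), (row_mx (invmx Q) 0 *m invmx L),
  (row_mx 0 1%:M *m invmx L); split.
- have H1 : col_mx 1%:M 0 *m Q *m row_mx (invmx Q) 0 = block_mx 1%:M 0 0 0
      :> 'M[R]_(k + d).
    by rewrite mul_col_mx mul1mx mul0mx mul_col_row mulmxV // mul0mx !mulmx0.
  have H2 : col_mx 0 1%:M *m row_mx 0 1%:M =
      block_mx 0 0 0 1%:M :> 'M[R]_(k + d).
    by rewrite mul_col_row mulmx1 !mulmx0 mulmx1.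
  have -> : L *m col_mx 1%:M 0 *m Q *m (row_mx (invmx Q) 0 *m invmx L) =
      L *m (col_mx 1%:M 0 *m Q *m row_mx (invmx Q) 0) *m invmx L.
    by rewrite !mulmxA.
  have -> : L *m col_mx 0 1%:M *m (row_mx 0 1%:M *m invmx L) =
      L *m (col_mx 0 1%:M *m row_mx 0 1%:M) *m invmx L.
    by rewrite !mulmxA.
  rewrite H1 H2 -mulmxDl -mulmxDr add_block_mx !addr0 add0r.
  by rewrite -scalar_mx_block mulmx1 mulmxV.
- rewrite !mulmxA -(mulmxA _ (invmx L)) mulVmx // mulmx1 mul_row_col mul0mx.
  by rewrite addr0 mulmx1 mulVmx.
- rewrite !mulmxA -(mulmxA _ (invmx L)) mulVmx // mulmx1 mul_row_col mul0mx.
  by rewrite mulmx0 addr0 mul0mx.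
- rewrite !mulmxA -(mulmxA _ (invmx L)) mulVmx // mulmx1 mul_row_col mul0mx.
  by rewrite mulmx0 addr0.
- rewrite !mulmxA -(mulmxA _ (invmx L)) mulVmx // mulmx1 mul_row_col mul0mx.
  by rewrite mulmx1 add0r.
Qed.

End Box.

Section SubmersionTrivial.
Variable R : realType.
Implicit Types X Y Z : dspace R.

(** The normal form of a submersion: in charts [phi] of [f], completing the
    differential of [phi] by a linear map [B] gives a local diffeomorphism
    [v |-> (phi v, v B)]. *)
Lemma submersion_trivial X Z (M : manifold R X) (N : manifold R Z) (f : X -> Z)
    (x : X) : arises_from X M -> arises_from Z N -> submersion M N f ->
  trivial_at f (mdim M - mdim N) x.
Proof.
move=> XM ZN [mf df].
have [c Mc cx] := atlas_cover M x; have [c' Nc' c'x] := atlas_cover N (f x).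
have [pc oc sc] := arises_dchart XM Mc.
have [pc' oc' sc'] := arises_dchart ZN Nc'.
have [oO sO] := mf _ _ Mc Nc'; have {}df := df _ _ _ Mc Nc' cx c'x.
set O := _ @` _ in oO sO; set phi := _ \o cinv c in sO df.
set k := mdim N in c' Nc' c'x pc' oc' sc' O phi oO sO df *.
set m := mdim M in c Mc cx pc oc sc O phi oO sO df *.
set p1 := cmap c x in df.
have Op1 : O p1 by exists x.
have dphi : differentiable phi p1 := smooth_on_differentiable sO Op1.
have fA : row_full ('J phi p1).
  rewrite -sub1mx; apply/row_subP => i.
  have [v vE] := df (row i 1%:M).
  by rewrite -vE -(mul_rV_lin1 ('d phi p1)) submxMl.
have [B [T1 [T2 [AB T1A T2A T1B T2B]]]] := row_full_complement fA.
pose Phi p := phi p *m T1 + p *m (B *m T2).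
have sPhi : smooth_on O Phi.
  apply: smooth_onD => //; first exact: smooth_on_mulmxr.
  by apply: (@smooth_on_mulmxr _ _ _ _ _ id) => //; apply: smooth_on_id.
have dPhi v : 'd Phi p1 v = v.
  pose L1 : {linear 'rV[R]_k -> 'rV[R]_m} := mulmxr T1.
  pose L2 : {linear 'rV[R]_m -> 'rV[R]_m} := mulmxr (B *m T2).
  have c1 : continuous L1 by exact: linear_rV_continuous.
  have c2 : continuous L2 by exact: linear_rV_continuous.
  have d1 : differentiable L1 (phi p1) by exact: linear_differentiable.
  have d2 : differentiable L2 p1 by exact: linear_differentiable.
  have d3 := differentiable_comp dphi d1.
  have E := congr1 (fun F : 'rV[R]_m -> 'rV[R]_m => F v) (diffD d3 d2).
  have E1 := congr1 (fun F : 'rV[R]_m -> 'rV[R]_m => F v) (diff_comp dphi d1).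
  have E2 := congr1 (fun F : 'rV[R]_m -> 'rV[R]_m => F v) (diff_lin p1 c2).
  have E3 := congr1 (fun F : 'rV[R]_k -> 'rV[R]_m => F ('d phi p1 v))
    (diff_lin (phi p1) c1).
  apply: etrans (etrans E (congr2 +%R (etrans E1 E3) E2)) _.
  rewrite /L1 /L2 /= -(mul_rV_lin1 ('d phi p1)) -[lin1_mx _]/('J phi p1).
  by rewrite -mulmxA -mulmxDr AB mulmx1.
have [U [V [Psi [[oU Up1 UO oV sPsi] [UV VU]]]]] :=
  inverse_function oO Op1 sPhi dPhi.
have phiE y : cdom c y -> phi (cmap c y) = cmap c' (f y).
  by move=> cy; rewrite /phi /= cmapK.
have OE v : O v -> cdom c (cinv c v) /\ cdom c' (f (cinv c v)) /\
    cmap c (cinv c v) = v.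
  by move=> [y [cy c'y] <-]; rewrite cmapK.
pose s u w := u *m T1 + w *m T2 : 'rV[R]_m.
have PhiE y : cdom c y -> Phi (cmap c y) = s (cmap c' (f y)) (cmap c y *m B).
  by move=> cy; rewrite /Phi phiE // /s mulmxA.
exists (fun y => cdom c y /\ U (cmap c y)), (fun y => cmap c y *m B),
  (fun z w => cdom c' z /\ V (s (cmap c' z) w)),
  (fun z w => cinv c (Psi (s (cmap c' z) w))); split; last by [].
split.
- move=> n W p pW.
  have -> : W `&` p @^-1` (fun y => cdom c y /\ U (cmap c y)) =
      (W `&` p @^-1` cdom c) `&` (cmap c \o p) @^-1` U.
    by apply/seteqP; split=> t [] => [Wt [ct Ut]|[Wt ct] Ut].
  by apply: open_setI_preimage => //; [exact: oc|exact: sc].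
- move=> n W p pW.
  apply: (smooth_on_sub (U := W `&` p @^-1` cdom c)); first by move=> t [Wt []].
  by apply: smooth_on_mulmxr; [exact: oc|exact: sc].
- move=> y [cy Uy]; have [_ [c'y _]] := OE _ (UO _ Uy).
  by rewrite cmapK // in c'y; split=> //; rewrite -PhiE //; have [] := UV _ Uy.
- by move=> y [cy Uy]; rewrite -PhiE //; have [_ ->] := UV _ Uy; rewrite cmapK.
- move=> z w [c'z Vq]; set q := s _ _ in Vq *.
  have [UPq PPq] := VU _ Vq; have [cy [c'y yE]] := OE _ (UO _ UPq).
  set y := cinv c (Psi q) in cy c'y yE *.
  have E : s (cmap c' (f y)) (cmap c y *m B) = q by rewrite -PhiE // yE PPq.
  split; first by rewrite yE.
    have := congr1 (fun v => v *m 'J phi p1) E.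
    rewrite /q /s !mulmxDl -!mulmxA T1A T2A !mulmx0 !addr0 !mulmx1.
    by move=> /(congr1 (cinv c')); rewrite !cmapK.
  have := congr1 (fun v => v *m B) E.
  by rewrite /q /s !mulmxDl -!(mulmxA _ _ B) T1B T2B !mulmx0 !add0r !mulmx1.
- move=> n W p w pW sw.
  pose W1 := W `&` p @^-1` cdom c'.
  have oW1 : open W1 by exact: oc'.
  have ss : smooth_on W1 (fun t => s (cmap c' (p t)) (w t)).
    apply: smooth_onD => //.
      by apply: smooth_on_mulmxr => //; exact: sc'.
    by apply: smooth_on_mulmxr => //; apply: smooth_on_sub sw => t [].
  have -> : W `&` [set t | cdom c' (p t) /\ V (s (cmap c' (p t)) (w t))] =
      W1 `&` (fun t => s (cmap c' (p t)) (w t)) @^-1` V.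
    by apply/seteqP; split=> t [] => [Wt [ct Ut]|[Wt ct] Ut].
  have oW2 := open_setI_preimage oW1 oV ss.
  split=> //.
  apply: (@plot_comp _ _ _ _ _ (cinv c) _
    (fun t => Psi (s (cmap c' (p t)) (w t))) pc oW2).
    apply: (smooth_on_comp oW2 oV _ _ sPsi); first by move=> t [].
    by apply: smooth_on_sub ss => t [].
  move=> t [_ /VU[UPt _]].
  have [cy [_ <-]] := OE _ (UO _ UPt).
  by exists (cinv c (Psi (s (cmap c' (p t)) (w t)))).
Qed.

End SubmersionTrivial.

(** * Fibre products *)

Section FibreProducts.
Variable R : realType.
Implicit Types X Y Z W : dspace R.

Lemma fibprod_plot X Y Z (f : X -> Z) (g : Y -> Z) n (U : set 'rV[R]_n)
    (P : 'rV[R]_n -> fibprod f g) :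
  plot U P <->
  plot U (fun t => (sval (P t)).1) /\ plot U (fun t => (sval (P t)).2).
Proof. by []. Qed.

Lemma fibprod_proj_smooth X Y Z (f : X -> Z) (g : Y -> Z) :
  dsmooth (fun P : fibprod f g => (sval P).2).
Proof. by move=> n U p []. Qed.

(** A pair of plots that agree over the base on their domain is a plot of the
    fibre product, once corrected outside the domain. *)
Lemma plot_fibprod X Y Z (f : X -> Z) (g : Y -> Z) (b : fibprod f g) n
    (U : set 'rV[R]_n) p q : plot U p -> plot U q ->
  (forall t, U t -> f (p t) = g (q t)) ->
  exists P : 'rV[R]_n -> fibprod f g,
    plot U P /\ forall t, U t -> sval (P t) = (p t, q t).
Proof.
move=> pU qU pq.
pose P t : fibprod f g := if pselect (f (p t) = g (q t)) is left e
  then fpair e else b.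
have PE t : U t -> sval (P t) = (p t, q t).
  by move=> Ut; rewrite /P; case: pselect => // nE; case: nE; exact: pq.
exists P; split=> //; apply/fibprod_plot; split.
  by apply: plot_ext pU _ => t Ut; rewrite PE.
by apply: plot_ext qU _ => t Ut; rewrite PE.
Qed.

(** Smoothness of a map on a fibre product, in terms of a total extension. *)
Lemma fibprod_smooth X Y Z W (f : X -> Z) (g : Y -> Z) (F : fibprod f g -> W)
    (G : X -> Y -> W) : dsmooth F ->
  (forall P : fibprod f g, G (sval P).1 (sval P).2 = F P) ->
  forall n (U : set 'rV[R]_n) p q, plot U p -> plot U q ->
    (forall t, U t -> f (p t) = g (q t)) -> plot U (fun t => G (p t) (q t)).
Proof.
move=> sF GF n U p q pU qU pq.
have [->|/set0P[t0 Ut0]] := eqVneq U set0; first exact: plot_set0.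
have [P [PU PE]] := plot_fibprod (fpair (pq _ Ut0)) pU qU pq.
by apply: plot_ext (sF _ _ _ PU) _ => t Ut /=; rewrite -GF PE.
Qed.

(** Trivialisations pull back along smooth maps, with the same fibre. *)
Lemma trivial_pullback X Y Z (f : X -> Z) (g : Y -> Z) d (P0 : fibprod f g) :
  dsmooth g -> trivial_at f d (sval P0).1 ->
  trivial_at (fun P : fibprod f g => (sval P).2) d P0.
Proof.
move=> sg [D [a [E [rho [T D0]]]]].
(* P0 is the default value, where rho does not land in the right fibre *)
pose rho' y u : fibprod f g :=
  if pselect (f (rho (g y) u) = g y) is left e then fpair e else P0.
have rhoE y u : E (g y) u -> sval (rho' y u) = (rho (g y) u, y).
  move=> Eyu; rewrite /rho'; case: pselect => // nE; case: nE.
  by have [] := triv_out T Eyu.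
exists (fun P => D (sval P).1), (fun P => a (sval P).1),
  (fun y u => E (g y) u), rho'; split=> //; split.
- by move=> n U p [pU _]; exact: (triv_open T pU).
- by move=> n U p [pU _]; exact: (triv_smooth T pU).
- by move=> [[y z] /= e] Dy; rewrite -e; exact: triv_in T _ Dy.
- move=> [[y z] /= e] Dy; have Ey := triv_in T Dy; rewrite e in Ey.
  apply: eq_sig_hprop => [P p q|]; first exact: Prop_irrelevance.
  rewrite rhoE //= -e; congr pair.
  exact: trivK T _ Dy.
- move=> y u Eyu; rewrite rhoE //=; have [Dr _ ar] := triv_out T Eyu.
  by split.
- move=> n U p w pU sw; have [oE pE] := triv_plot T (sg _ _ _ pU) sw.
  split; first exact: oE.
  apply/fibprod_plot; split.
    by apply: plot_ext pE _ => t [Ut Et]; rewrite rhoE.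
  apply: (@plot_ext _ _ _ _ p).
    by apply: plot_sub pU oE _ => t [].
  by move=> t [Ut Et]; rewrite rhoE.
Qed.

(** The fibre product of a locally trivial map and a smooth map into the same
    manifold is a manifold. *)
Lemma fibprod_manifold X Y Z (f : X -> Z) (g : Y -> Z) d k :
  (forall x, trivial_at f d x) -> dsmooth g -> locally_euclidean Y k ->
  exists M : manifold R (fibprod f g), arises_from (fibprod f g) M.
Proof.
move=> tf sg Yk; apply: locally_euclidean_manifold.
apply: trivial_locally_euclidean (@fibprod_proj_smooth _ _ _ f g) _ Yk.
by move=> P; apply: trivial_pullback.
Qed.

End FibreProducts.

(** * Principal actions *)

Section PrincipalActions.
Variable R : realType.
Implicit Types X B Z A : dspace R.

(** Lifting the inverse of a chart of the base along a subduction gives local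
    sections, smooth in the sense that they map plots to plots. *)
Lemma subduction_section X B (l : X -> B) k (c : chart R B k) (b : B) :
  subduction l -> dchart c -> cdom c b ->
  exists (W : set B) (sigma : B -> X), [/\ dopen W, W b,
    forall b', W b' -> l (sigma b') = b' &
    forall n (U : set 'rV[R]_n) p, plot U p ->
      plot (U `&` p @^-1` W) (sigma \o p)].
Proof.
move=> [_ _ sl] [pc oc sc] cb.
have [I [V [q [VE Vq]]]] := sl _ _ _ pc.
have : (cmap c @` cdom c) (cmap c b) by exists b.
rewrite VE => -[i _ Vib]; have [qi qiE] := Vq i.
have oV := plot_open qi.
exists (fun b' => cdom c b' /\ V i (cmap c b')), (q i \o cmap c).
have WE n (U : set 'rV[R]_n) (p : 'rV[R]_n -> B) :
    U `&` p @^-1` (fun b' => cdom c b' /\ V i (cmap c b')) =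
    (U `&` p @^-1` cdom c) `&` (cmap c \o p) @^-1` V i.
  by apply/seteqP; split=> t [] => [Ut [ct Vt]|[Ut ct] Vt].
have oW n (U : set 'rV[R]_n) (p : 'rV[R]_n -> B) : plot U p ->
    open (U `&` p @^-1` (fun b' => cdom c b' /\ V i (cmap c b'))).
  move=> pU; rewrite WE.
  by apply: open_setI_preimage => //; [exact: oc|exact: sc].
split=> //.
- by move=> b' [cb' Vb'] /=; rewrite -qiE // cmapK.
- move=> n U p pU.
  apply: (@plot_comp _ _ _ _ _ (q i) _ (cmap c \o p) qi); first exact: oW.
    by rewrite WE; apply: smooth_on_sub (sc _ _ _ pU) => t [].
  by move=> t [_ []].
Qed.

(** Let [theta x a], defined when [r x = t a], be such that each [theta x] is a
    bijection onto the fibre of [l] through [x], with smooth inverse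
    [delta x].  Along a local section [sigma] of [l], the fibres of [l] are then
    those of [t] over the base points [r (sigma b)], and a local triviality of
    [t] transfers to [l]. *)
Lemma principal_trivial X B Z A (l : X -> B) (r : X -> Z) (t : A -> Z) d k
    (theta : X -> A -> X) (delta : X -> X -> A) :
  subduction l -> dsmooth r -> locally_euclidean B k ->
  (forall a, trivial_at t d a) ->
  (forall x a, r x = t a -> l (theta x a) = l x) ->
  (forall x a, r x = t a -> delta x (theta x a) = a) ->
  (forall x y, l x = l y -> r x = t (delta x y) /\ theta x (delta x y) = y) ->
  (forall n (U : set 'rV[R]_n) p q, plot U p -> plot U q ->
    (forall z, U z -> r (p z) = t (q z)) ->
    plot U (fun z => theta (p z) (q z))) ->
  (forall n (U : set 'rV[R]_n) p q, plot U p -> plot U q ->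
    (forall z, U z -> l (p z) = l (q z)) ->
    plot U (fun z => delta (p z) (q z))) ->
  forall x, trivial_at l d x.
Proof.
move=> subl sr Bk tt l_theta deltaK thetaK s_theta s_delta x.
have [c dc cx] := Bk (l x); have [sl _ _] := subl.
have [W [sigma [oW Wx sigmaK s_sigma]]] := subduction_section subl dc cx.
pose dl y := delta (sigma (l y)) y.
have [D [a [E [rho [T Dx]]]]] := tt (dl x).
have dlP y : W (l y) -> r (sigma (l y)) = t (dl y) /\
    theta (sigma (l y)) (dl y) = y.
  by move=> Wy; apply: thetaK; rewrite sigmaK.
have p_dl n (U : set 'rV[R]_n) (p : _ -> X) : plot U p ->
    open (U `&` p @^-1` (l @^-1` W)) /\
    plot (U `&` p @^-1` (l @^-1` W)) (dl \o p).
  move=> pU; have plU := sl _ _ _ pU.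
  have oU1 := oW _ _ _ plU.
  split=> //; apply: s_delta; first exact: s_sigma plU.
    by apply: plot_sub pU oU1 _ => z [].
  by move=> z [Uz Wz] /=; rewrite sigmaK.
have DE n (U : set 'rV[R]_n) (p : _ -> X) :
    U `&` p @^-1` (fun y => W (l y) /\ D (dl y)) =
    (U `&` p @^-1` (l @^-1` W)) `&` (dl \o p) @^-1` D.
  by apply/seteqP; split=> z [] => [Uz [Wz Dz]|[Uz Wz] Dz].
exists (fun y => W (l y) /\ D (dl y)), (fun y => a (dl y)),
  (fun b u => W b /\ E (r (sigma b)) u),
  (fun b u => theta (sigma b) (rho (r (sigma b)) u)); split=> //; split.
- by move=> n U p pU; rewrite DE; have [_ /(triv_open T)] := p_dl _ _ _ pU.
- by move=> n U p pU; rewrite DE; have [_ /(triv_smooth T)] := p_dl _ _ _ pU.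
- move=> y [Wy Dy]; split=> //.
  by have [-> _] := dlP _ Wy; exact: triv_in T _ Dy.
- move=> y [Wy Dy]; have [E1 E2] := dlP _ Wy.
  by rewrite E1 (trivK T Dy).
- move=> b u [Wb Ebu]; have [Dr tr ar] := triv_out T Ebu.
  have lE : l (theta (sigma b) (rho (r (sigma b)) u)) = b.
    by rewrite l_theta // sigmaK.
  have dlE : dl (theta (sigma b) (rho (r (sigma b)) u)) = rho (r (sigma b)) u.
    by rewrite /dl lE deltaK.
  by rewrite lE dlE; split.
- move=> n U p w pU sw; have oU1 := oW _ _ _ pU.
  have p1 := s_sigma _ _ _ pU; have p2 := sr _ _ _ p1.
  have sw1 : smooth_on (U `&` p @^-1` W) w by apply: smooth_on_sub sw => z [].
  have [oE pE] := triv_plot T p2 sw1.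
  have -> : U `&` [set z | W (p z) /\ E (r (sigma (p z))) (w z)] =
      U `&` p @^-1` W `&` [set z | E ((r \o (sigma \o p)) z) (w z)].
    by apply/seteqP; split=> z [] => [Uz [Wz Dz]|[Uz Wz] Dz].
  split=> //; apply: s_theta => //.
    by apply: plot_sub p1 oE _ => z [].
  by move=> z [_ /= Ez]; have [_ -> _] := triv_out T Ez.
Qed.

End PrincipalActions.

(** * Biprincipal bibundles of Lie groupoids *)

Section Bibundles.
Variable R : realType.

Lemma fpair_sval (X Y : dspace R) (Z : Type) (f : X -> Z) (g : Y -> Z)
    (P : fibprod f g) (e : f (sval P).1 = g (sval P).2) : fpair e = P.
Proof.
by case: P e => -[x y] e0 /= e; rewrite (Prop_irrelevance e e0).
Qed.

(** For a right principal bibundle, the left anchor is locally a pullback of the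
    target of [H]. *)
Lemma right_principal_trivial (G H : dgroupoid R) (X : bibundle G H) d k :
  right_principal X -> locally_euclidean (obj G) k ->
  (forall h, trivial_at (@tgt R H) d h) ->
  forall x, trivial_at (@lanch R G H X) d x.
Proof.
move=> [subl [_ [F [sF rdivK FK]]]] Gk tt.
pose theta (x : X) (h : arr H) : X :=
  if pselect (ranch x = tgt h) is left e then ract (fpair e) else x.
pose delta (x y : X) : arr H :=
  if pselect (lanch x = lanch y) is left e then (sval (F (fpair e))).2
  else unt (ranch x).
have thetaE P : theta (sval P).1 (sval P).2 = ract P.
  rewrite /theta; case: pselect => [e|nE]; first by rewrite fpair_sval.
  by case: nE; exact: (svalP P).
have deltaE P : delta (sval P).1 (sval P).2 = (sval (F P)).2.
  rewrite /delta; case: pselect => [e|nE]; first by rewrite fpair_sval.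
  by case: nE; exact: (svalP P).
apply: (principal_trivial (r := @ranch R G H X) (theta := theta)
  (delta := delta))
  subl _ Gk tt _ _ _ _ _.
- exact: ranch_smooth.
- move=> x h e; have := thetaE (fpair e); rewrite /= => ->.
  by rewrite lanch_ract.
- move=> x h e; have := thetaE (fpair e); rewrite /= => ->.
  by have := deltaE (rdiv (fpair e)); rewrite rdivK.
- move=> x y e; have := deltaE (fpair e); rewrite /= => ->.
  have := FK (fpair e); move: (F _) => [[x' h] /= e'] Fe.
  have [E1 E2] := congr1 sval Fe; rewrite -E1; split=> //.
  by have := thetaE (fpair e'); rewrite /= => ->.
- exact: fibprod_smooth (@ract_smooth _ _ _ X) thetaE.
- apply: (fibprod_smooth (F := fun P => (sval (F P)).2)) deltaE.
  by move=> n U p /sF[].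
Qed.

(** For a left principal bibundle, the right anchor is locally a pullback of the
    source of [G]. *)
Lemma left_principal_trivial (G H : dgroupoid R) (X : bibundle G H) d k :
  left_principal X -> locally_euclidean (obj H) k ->
  (forall g, trivial_at (@src R G) d g) ->
  forall x, trivial_at (@ranch R G H X) d x.
Proof.
move=> [subr [_ [F [sF ldivK FK]]]] Hk ts.
pose theta (x : X) (g : arr G) : X :=
  if pselect (src g = lanch x) is left e then lact (fpair e) else x.
pose delta (x y : X) : arr G :=
  if pselect (ranch y = ranch x) is left e then (sval (F (fpair e))).1
  else unt (lanch x).
have thetaE P : theta (sval P).2 (sval P).1 = lact P.
  rewrite /theta; case: pselect => [e|nE]; first by rewrite fpair_sval.
  by case: nE; exact: (svalP P).
have deltaE P : delta (sval P).2 (sval P).1 = (sval (F P)).1.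
  rewrite /delta; case: pselect => [e|nE]; first by rewrite fpair_sval.
  by case: nE; exact: (svalP P).
apply: (principal_trivial (r := @lanch R G H X) (theta := theta)
  (delta := delta))
  subr _ Hk ts _ _ _ _ _.
- exact: lanch_smooth.
- move=> x g /esym e; have := thetaE (fpair e); rewrite /= => ->.
  by rewrite ranch_lact.
- move=> x g /esym e; have := thetaE (fpair e); rewrite /= => ->.
  by have := deltaE (ldiv (fpair e)); rewrite ldivK.
- move=> x y /esym e; have := deltaE (fpair e); rewrite /= => ->.
  have := FK (fpair e); move: (F _) => [[g x'] /= e'] Fe.
  have [E1 E2] := congr1 sval Fe; rewrite -E2; split=> //.
  by have := thetaE (fpair e'); rewrite /= => ->.
- move=> n U p q pU qU pq.
  apply: (fibprod_smooth (@lact_smooth _ _ _ X)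
    (G := fun g x => theta x g) thetaE qU pU) => z Uz.
  by rewrite pq.
- move=> n U p q pU qU pq.
  apply: (fibprod_smooth (F := fun P => (sval (F P)).1)
    (G := fun y x => delta x y) _ deltaE qU pU) => [m V P /sF[]//|z Uz].
  by rewrite pq.
Qed.

End Bibundles.

Theorem corollary6p9 (R : realType) (G H : lie_groupoid R) (X : bibundle G H) :
  biprincipal X -> lie_biprincipal X.
Proof.
move=> [rX lX].
have G0 := arises_locally_euclidean (@mobj_arises _ G).
have H0 := arises_locally_euclidean (@mobj_arises _ H).
have ts g := submersion_trivial g (@marr_arises _ G) (@mobj_arises _ G)
  (src_submersion G).
have tt h := submersion_trivial h (@marr_arises _ H) (@mobj_arises _ H)
  (tgt_submersion H).
(* both anchors are locally trivial; X takes its charts from those of obj G *)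
have tl := right_principal_trivial rX G0 tt.
have tr := left_principal_trivial lX H0 ts.
have sl := @lanch_smooth _ _ _ X; have sr := @ranch_smooth _ _ _ X.
have [MX XM] := locally_euclidean_manifold (trivial_locally_euclidean sl tl G0).
have EX := arises_locally_euclidean XM.
have EH := arises_locally_euclidean (@marr_arises _ H).
have [ML LM] := fibprod_manifold ts sl EX.
have [MR RM] := fibprod_manifold tr (@tgt_smooth _ H) EH.
have [Mll llM] := fibprod_manifold tl sl EX.
have [Mrr rrM] := fibprod_manifold tr sr EX.
exists MX; split=> //.
- split; first by have [[_]] := rX.
  exact: trivial_submersion XM (@mobj_arises _ G) sl tl.
- split; first by have [[_]] := lX.
  exact: trivial_submersion XM (@mobj_arises _ H) sr tr.
exists ML, MR, Mll, Mrr; split; first by [].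
split.
- exact: dsmooth_msmooth LM XM (@lact_smooth _ _ _ X).
- exact: dsmooth_msmooth RM XM (@ract_smooth _ _ _ X).
- by apply: diffeomorphism_mdiffeomorphism => //; case: rX.
- by apply: diffeomorphism_mdiffeomorphism => //; case: lX.
Qed.
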